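(* Let $X$ be the dendrite constructed in the context. Then the natural action $\mathrm{Homeo}(X)\curvearrowright X$ is not $\mathrm{tame}_1$.
   Context: A dendrite is a compact, connected, locally connected, metrizable space $X$ such that any two points $x,y\in X$ are the endpoints of a unique arc $[x,y]$ in $X$. The order of $x\in X$ is the number of connected components of $X\setminus\{x\}$; $x$ is an endpoint if its order is $1$ and a ramification point if its order is at least $3$. An arc $[x,y]$ is free if $[x,y]\setminus\{x,y\}$ is open in the dendrite, and a free arc is maximal if it is not properly contained in another free arc. Construction of $X$. Let $T_0$ and $T_1$ be two copies of $[0,1]$ with fixed countable dense sets $D_0\subseteq T_0$, $D_1\subseteq T_1$, with $1\notin D_i$ and $n/(n+1)\notin D_i$ for all $n\in\omega$ and $i\in\{0,1\}$. In $T_0$, colour the points of $D_0\cap(n/(n+1),(n+1)/(n+2))$ red if $n$ is even and green if $n$ is odd. In $T_1$, colour the points of $D_1\cap(n/(n+1),(n+1)/(n+2))$ green if $n$ is even and red if $n$ is odd. Let $X_0$ be four copies of $T_0$ identified at $0$. Given $X_i$, each maximal free arc $A$ of $X_i$ is by construction a copy of $T_0$ or $T_1$, and so carries a corresponding coloured countable dense set $D(A)$. For $a\in D(A)$ let $T(a)=T_0\vee T_0$ (two copies of $T_0$ joined at $0$) if $a$ is red, and $T(a)=T_1$ if $a$ is green. Form $X_{i+1}$ by attaching to $X_i$ a copy of $T(a)$ at each $a\in D(A)$, for every maximal free arc $A$ of $X_i$, so that: the point $0$ of $T(a)$ is $a$; $X_i\cap T(a)=\{a\}$; the sets $T(a)$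 for distinct $a$ are pairwise disjoint; for each $\varepsilon>0$ only finitely many $a$ satisfy $\mathrm{diam}(T(a))>\varepsilon$; and $\mathrm{diam}(T(a))<2^{-i}$ for all $a$ (the $X_i$ being realized as an increasing chain of subspaces of the plane). Each $X_i$ is a dendrite. Let $f^{i+1}_i:X_{i+1}\to X_i$ be the map which is the identity on $X_i$ and sends all of $T(a)$ to $a$. Then $X=\varprojlim(X_i,f^{i+1}_i)$, which is a dendrite all of whose ramification points have order $3$ or $4$. A dynamical system $(X,G)$ is a continuous (faithful) action of a topological group $G$ on a compact space $X$. Its Ellis semigroup $E(X,G)$ is the closure of $G$ (identified with $\{x\mapsto gx : g\in G\}$) in $X^X$ with the topology of pointwise convergence. For a compact metrizable $X$, $\mathrm{Homeo}(X)$ carries the compact-open topology. A function $f:Z\to Y$ between Polish spaces is Baire class 1 if $f^{-1}(U)$ is $F_\sigma$ for every open $U\subseteq Y$. A space is a Rosenthal compactum if it is homeomorphic to a compact subspace of $B_1(Z,\mathbb{R})$, the space of Baire class 1 functions $Z\to\mathbb{R}$ with the pointwise convergence topology, for some Polish space $Z$. A dynamical system $(X,G)$ is $\mathrm{tame}_1$ if $E(X,G)$ is a first countable Rosenthal compactum. *)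

(* Defs.v *)
From HB Require Import structures.
From mathcomp Require Import all_boot all_order all_algebra.
From mathcomp Require Import all_classical all_reals all_analysis.
From mathcomp Require Import borel_hierarchy.

Set Implicit Arguments.
Unset Strict Implicit.
Unset Printing Implicit Defensive.

Import Order.TTheory GRing.Theory Num.Theory.
Import numFieldNormedType.Exports.

Local Open Scope classical_set_scope.
Local Open Scope ring_scope.

Definition homeomorphism (X Y : topologicalType) (f : X -> Y) : Prop :=
  continuous f /\
  exists g : Y -> X, [/\ continuous g, cancel f g & cancel g f].

Definition homeomorphic (X Y : topologicalType) : Prop :=
  exists f : X -> Y, homeomorphism f.

Definition first_countable (T : topologicalType) : Prop :=
  forall x : T, exists2 B : set (set T), countable B &
    (forall V, B V -> nbhs x V) /\
    (forall U, nbhs x U -> exists2 V, B V & V `<=` U).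

(* The metric of a Polish space is carried by a homeomorphic copy, because the
   library has no predicate for metrizability of a bare topological space.  A
   Hausdorff pseudometric space is a metric space. *)
Definition polish (R : realType) (Z : topologicalType) : Prop :=
  (exists2 S : set Z, countable S & dense S) /\
  exists M : completePseudoMetricType R, hausdorff_space M /\ homeomorphic Z M.

Definition baire_class1 (Z Y : topologicalType) (f : Z -> Y) : Prop :=
  forall U : set Y, open U -> Fsigma (f @^-1` U).

Definition rosenthal_compactum (R : realType) (K : topologicalType) : Prop :=
  exists2 Z : topologicalType, polish R Z &
  exists C : set {ptws Z -> R},
    [/\ C `<=` [set f | baire_class1 (f : Z -> R)],
        compact C & homeomorphic K (set_type C)].

Definition ellis (G X : topologicalType) (act : G -> X -> X) :
    set {ptws X -> X} :=
  closure [set (act g : {ptws X -> X}) | g in [set: G]].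

Definition tame1 (R : realType) (G X : topologicalType) (act : G -> X -> X) :
    Prop :=
  first_countable (set_type (ellis act)) /\
  rosenthal_compactum R (set_type (ellis act)).

(* As a subtype of {compact-open, X -> X} it carries the compact-open
   topology. *)
Definition Homeo (X : topologicalType) : topologicalType :=
  set_type [set f : {compact-open, X -> X} | homeomorphism (f : X -> X)].

Definition homeo_act (X : topologicalType) (g : Homeo X) : X -> X :=
  set_val g.

Section Plane.
Context {R : realType}.
Local Notation plane := (R * R)%type.

Definition edist (p q : plane) : R :=
  Num.sqrt ((p.1 - q.1) ^+ 2 + (p.2 - q.2) ^+ 2).

(* Only meaningful for nonempty bounded sets; it is used on compact ones. *)
Definition diam (A : set plane) : R := sup [set edist p q | p in A & q in A].

(* [0, 1] being compact, a continuous injection is a homeomorphism onto its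
   image. *)
Definition parametrizes (phi : R -> plane) (A : set plane) : Prop :=
  [/\ {within `[0, 1], continuous phi},
      set_inj `[0, 1] phi & phi @` `[0, 1] = A].

Definition arc_between (A : set plane) (x y : plane) : Prop :=
  exists phi, [/\ parametrizes phi A, phi 0 = x & phi 1 = y].

Definition free_arc (X A : set plane) : Prop :=
  A `<=` X /\
  exists x y, arc_between A x y /\ open (A `\` [set x; y] : set (subspace X)).

Definition maximal_free_arc (X A : set plane) : Prop :=
  free_arc X A /\ forall B, free_arc X B -> A `<=` B -> A = B.

End Plane.

(* In what follows a boolean k names a kind of copy of [0, 1]: false for T_0 and
   true for T_1. *)

Definition breakpoint (R : realType) (n : nat) : R := n%:R / n.+1%:R.

Record dense_marking (R : realType) (D : bool -> set R) : Prop := DenseMarking {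
  marking_sub : forall k, D k `<=` `[0, 1];
  marking_countable : forall k, countable (D k);
  marking_dense : forall k, `[0, 1] `<=` closure (D k);
  marking_one : forall k, ~ D k 1;
  marking_breakpoint : forall k n, ~ D k (breakpoint R n)
}.

Definition red (R : realType) (k : bool) (t : R) : Prop :=
  exists n, breakpoint R n < t < breakpoint R n.+1 /\ odd n = k.

Definition green (R : realType) (k : bool) (t : R) : Prop :=
  exists n, breakpoint R n < t < breakpoint R n.+1 /\ odd n = ~~ k.

(* stage i is X_i and twig i a is the set T(a) attached to X_i at a.  A maximal
   free arc A of X_i is a copy of T_(kind i A) through chart i A; the values of
   kind and chart at other sets are irrelevant. *)
Record tower (R : realType) := Tower {
  stage : nat -> set (R * R);
  kind : nat -> set (R * R) -> bool;
  chart : nat -> set (R * R) -> R -> R * R;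
  twig : nat -> R * R -> set (R * R)
}.

Section Construction.
Context {R : realType} (D : bool -> set R) (S : tower R).
Local Notation plane := (R * R)%type.

Definition copy_from (i : nat) (k : bool) (A : set plane) (o : plane) : Prop :=
  [/\ kind S i A = k, parametrizes (chart S i A) A & chart S i A 0 = o].

Definition red_points (i : nat) : set plane :=
  [set a | exists A t, [/\ maximal_free_arc (stage S i) A,
    D (kind S i A) t, red (kind S i A) t & a = chart S i A t]].

Definition green_points (i : nat) : set plane :=
  [set a | exists A t, [/\ maximal_free_arc (stage S i) A,
    D (kind S i A) t, green (kind S i A) t & a = chart S i A t]].

Definition attaching_points (i : nat) : set plane :=
  red_points i `|` green_points i.

Record dendrite_tower : Prop := DendriteTower {
  tower_base : exists (o : plane) (A : 'I_4 -> set plane),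
    [/\ forall k, copy_from 0 false (A k) o,
        forall k l, k != l -> A k `&` A l = [set o] &
        stage S 0 = \bigcup_k A k];
  tower_red : forall i a, red_points i a -> exists A B,
    [/\ copy_from i.+1 false A a, copy_from i.+1 false B a,
        A `&` B = [set a] & twig S i a = A `|` B];
  tower_green : forall i a, green_points i a ->
    copy_from i.+1 true (twig S i a) a;
  tower_step : forall i,
    stage S i.+1 = stage S i `|` \bigcup_(a in attaching_points i) twig S i a;
  tower_meet : forall i a, attaching_points i a ->
    stage S i `&` twig S i a = [set a];
  tower_disjoint : forall i a b, attaching_points i a ->
    attaching_points i b -> a != b -> twig S i a `&` twig S i b = set0;
  tower_null : forall i (eps : R), 0 < eps ->
    finite_set [set a | attaching_points i a /\ eps < diam (twig S i a)];
  tower_small : forall i a, attaching_points i a ->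
    diam (twig S i a) < 2 ^- i
}.

(* The map f^(i+1)_i; the default value of xget is never used on X_(i+1). *)
Definition bond (i : nat) (p : plane) : plane :=
  if p \in stage S i then p
  else xget p [set a | attaching_points i a /\ twig S i a p].

Definition limit_dendrite : topologicalType :=
  set_type [set x : prod_topology (fun _ : nat => plane) |
    forall i, stage S i (x i) /\ bond i (x i.+1) = x i].

End Construction.

(* Main.v *)
Require Import Defs.
From HB Require Import structures.
From mathcomp Require Import all_boot all_order all_algebra.
From mathcomp Require Import all_classical all_reals all_analysis.
From mathcomp Require Import lra.

(* It is first countability of the Ellis semigroup that fails.  A point x of X is
   described by coordinates: for every finite word w of letters (t, b), with t
   the parameter of an attaching point and b the choice of an arc of its twig,
   the word w is the address of an arc, and the w-coordinate of x is the
   parameter of the projection of x to that arc (0 if x does not lie beyond the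
   start of the arc).  The sequences of coordinates of points are exactly the
   coherent ones, so a homeomorphism of X is obtained by rewriting addresses.

   For u a red point of the first half of the first arm, one can exchange the
   part of that arm beyond u with a twig arc at u (a back-and-forth argument
   makes the two arcs isomorphic as marked arcs), and one can slide the first
   arm towards its origin o.  For every end x of X whose address is
   (c, b_0), (c, b_1), ..., compositions of these maps push any finite set of
   points that avoids x close to the retraction q of X that collapses the first
   arm to o, while x stays away from o.  As there are uncountably many such
   ends, countably many neighbourhoods of q in the Ellis semigroup, each of
   which contains a condition on finitely many points only, never form a base. *)

Set Implicit Arguments.
Unset Strict Implicit.
Unset Printing Implicit Defensive.

Import Order.TTheory GRing.Theory Num.Theory.
Import numFieldNormedType.Exports.

Local Open Scope classical_set_scope.
Local Open Scope ring_scope.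

(** * Isomorphisms of marked intervals *)

(** The bound 1/2 is what makes the exchanges possible. On a copy of T_0 the marks in (0, 1/2) are
    all red, so every twig there is a pair of copies of T_0, and a map that respects marks below 1/2
    and is the identity from 1/2 on respects colours as well; the back-and-forth argument can ignore
    them. The two arcs of a red twig also make the ends uncountable: with one fixed mark c below
    1/2, the choices b_n run through all binary sequences. Homeomorphisms are never glued from
    pieces of the plane. As X is compact and its coordinates are continuous, injective and onto the
    coherent families, an invertible rewriting that preserves coherence, with continuous coordinates
    in both directions, is a homeomorphism. The price is paid in constructing the coordinates. The
    attaching points of a stage are defined through its maximal free arcs, which are known by
    maximality only; so an induction must show that those of X_i are exactly the arcs addressed by
    words of length i. What prevents larger free arcs is a triod at each attaching point and at
    o. *)

Section OrderIso.
Context {R : realType}.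
Implicit Types (F G : R -> R) (A B : set R) (P : R -> R -> Prop).

(** Taken on the whole line, so that inverting and gluing involve no domains; only the behaviour on
    [0, 1] has a geometric meaning. *)
Definition order_iso F G : Prop :=
  [/\ cancel F G, cancel G F & {mono F : x y / x <= y}].

Lemma order_iso_sym F G : order_iso F G -> order_iso G F.
Proof.
by case=> FK GK mF; split=> // x y; rewrite -{2}[x]GK -{2}[y]GK mF.
Qed.

Definition isotone_rel P : Prop :=
  forall a b a' b', P a b -> P a' b' -> (a < a') = (b < b').

Definition dense_in_line A : Prop := forall x y, x < y -> exists2 a, A a & x < a < y.

Section Completion.
Variable P : R -> R -> Prop.
Hypothesis isoP : isotone_rel P.
Hypothesis domP : dense_in_line [set a | exists b, P a b].
Hypothesis codP : dense_in_line [set b | exists a, P a b].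

(** The extension of a partial isomorphism by Dedekind cuts; when both projections of [P] are dense,
    it is the only increasing map through the pairs of [P]. *)
Definition completion (x : R) : R := sup [set b | exists2 a, P a b & a <= x].

Lemma completion_has_sup x : has_sup [set b | exists2 a, P a b & a <= x].
Proof.
split.
  have [|a [b Pab] /andP[_ ax]] := @domP (x - 1) x; first by lra.
  by exists b, a => //; exact: ltW.
have [|a [b Pab] /andP[xa _]] := @domP x (x + 1); first by lra.
exists b => b' [a' Pab' a'x]; apply: ltW.
by rewrite -(isoP Pab' Pab) (le_lt_trans a'x).
Qed.

Lemma completion_ge a b x : P a b -> a <= x -> b <= completion x.
Proof.
by move=> Pab ax; apply: ub_le_sup; [case: (completion_has_sup x)|exists a].
Qed.

Lemma completion_le a b x : P a b -> x <= a -> completion x <= b.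
Proof.
move=> Pab xa; apply: ge_sup; first by case: (completion_has_sup x).
move=> b' [a' Pab' a'x]; rewrite leNgt -(isoP Pab Pab') -leNgt.
exact: le_trans xa.
Qed.

Lemma completion_eq a b : P a b -> completion a = b.
Proof.
move=> Pab; apply/eqP; rewrite eq_le.
by rewrite (completion_le Pab)// (completion_ge Pab).
Qed.

Lemma completion_lt x y : x < y -> completion x < completion y.
Proof.
move=> xy; have [a [b Pab] /andP[xa ay]] := domP xy.
have [a' [b' Pab'] /andP[xa' ay']] := domP xa.
apply: (le_lt_trans (completion_le Pab' (ltW xa'))).
apply: lt_le_trans (completion_ge Pab (ltW ay)).
by rewrite -(isoP Pab' Pab).
Qed.

End Completion.

(** If [x] differed from its image under both completions, a point [a] of the dense domain would lie
    strictly between them, and comparison with [a] and its partner [b] gives a contradiction. *)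
Lemma completion_cancel P : isotone_rel P ->
  dense_in_line [set a | exists b, P a b] ->
  dense_in_line [set b | exists a, P a b] ->
  cancel (completion P) (completion (fun b a => P a b)).
Proof.
move=> isoP domP codP x; set Q := fun b a => P a b.
have isoQ : isotone_rel Q by move=> b a b' a' Q1 Q2; rewrite (isoP a b a' b').
have hx := completion_lt isoP domP; set y := completion P x.
apply/eqP; rewrite eq_le; apply/andP; split; rewrite leNgt; apply/negP => xG.
  have [a [b Pab] /andP[xa aG]] := domP _ _ xG.
  have := completion_le isoQ codP Pab (ltW (lt_le_trans (hx _ _ xa) _)).
  rewrite (completion_eq isoP domP Pab) => /(_ (lexx _)).
  by rewrite leNgt aG.
have [a [b Pab] /andP[xa aG]] := domP _ _ xG.
have /= := completion_ge isoQ codP Pab (ltW (le_lt_trans _ (hx _ _ aG))).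
rewrite (completion_eq isoP domP Pab) => /(_ (lexx _)).
by rewrite leNgt xa.
Qed.

Lemma isotone_rel_order_iso P : isotone_rel P ->
  dense_in_line [set a | exists b, P a b] ->
  dense_in_line [set b | exists a, P a b] ->
  exists F G, order_iso F G /\ forall a b, P a b -> F a = b.
Proof.
move=> isoP domP codP.
exists (completion P), (completion (fun b a => P a b)); split; last first.
  exact: completion_eq.
have isoQ : isotone_rel (fun b a => P a b).
  by move=> b a b' a' Q1 Q2; rewrite (isoP a b a' b').
split; [exact: completion_cancel| exact: (completion_cancel isoQ)|].
by apply: le_mono => x y; exact: completion_lt.
Qed.

(** * Cantor's back-and-forth argument *)

Section BackAndForth.

(** Together with countability, the hypotheses of Cantor's theorem on dense orders without
    endpoints. *)
Definition order_like A : Prop :=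
  [/\ A !=set0, (forall x, A x -> exists2 y, A y & y < x),
      (forall x, A x -> exists2 y, A y & x < y) &
      (forall x y, A x -> A y -> x < y -> exists2 z, A z & x < z < y)].

Lemma seq_max (s : seq R) : s != [::] -> exists2 m, m \in s & {in s, forall x, x <= m}.
Proof.
elim: s => // x s IH _; have [->|/IH[m ms mP]] := eqVneq s [::].
  by exists x; rewrite ?mem_head// => y; rewrite inE => /eqP ->.
exists (Num.max x m).
  by rewrite inE; case: leP => _; rewrite ?eqxx// ms orbT.
move=> y; rewrite inE => /orP[/eqP->|/mP ym]; rewrite le_max ?lexx//.
by rewrite ym orbT.
Qed.

Lemma seq_min (s : seq R) : s != [::] -> exists2 m, m \in s & {in s, forall x, m <= x}.
Proof.
move=> s0; have [|m] := @seq_max (map -%R s); first by case: (s) s0.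
case/mapP => x xs -> xP; exists x => // y ys.
by rewrite -lerN2; apply: xP; exact: map_f.
Qed.

Lemma order_like_between B (L U : seq R) : order_like B ->
  {in L, forall x, B x} -> {in U, forall x, B x} ->
  {in L & U, forall x y, x < y} ->
  exists b, [/\ B b, {in L, forall x, x < b} & {in U, forall y, b < y}].
Proof.
move=> [[b0 B0] dn up mid] LB UB LU.
have [->|/seq_max[l lL lP]] := eqVneq L [::];
  have [->|/seq_min[u uU uP]] := eqVneq U [::].
- by exists b0.
- have [b Bb bu] := dn _ (UB _ uU); exists b; split=> // y /uP.
  exact: lt_le_trans.
- have [b Bb bu] := up _ (LB _ lL); exists b; split=> // y /lP yl.
  exact: le_lt_trans bu.
have [b Bb /andP[lb bu]] := mid _ _ (LB _ lL) (UB _ uU) (LU _ _ lL uU).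
exists b; split=> // y; first by move=> /lP yl; exact: le_lt_trans lb.
by move=> /uP; exact: lt_le_trans.
Qed.

Definition partial_iso A B (s : seq (R * R)) : Prop :=
  (forall p, p \in s -> A p.1 /\ B p.2) /\
  (forall p p', p \in s -> p' \in s -> (p.1 < p'.1) = (p.2 < p'.2)).

Definition swap_pairs (s : seq (R * R)) := [seq (p.2, p.1) | p <- s].

Lemma partial_iso_swap A B s : partial_iso A B s -> partial_iso B A (swap_pairs s).
Proof.
move=> [sAB iso]; split; first by move=> _ /mapP[p /sAB[? ?] ->].
by move=> _ _ /mapP[p ps ->] /mapP[p' ps' ->] /=; rewrite iso.
Qed.

(** The forth step: the partner of a new [x] is placed between the partners of the points below [x]
    and those of the points above; an [x] that occurs already keeps its partner. *)
Lemma partial_iso_extend A B s x : order_like B -> partial_iso A B s -> A x ->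
  exists y, partial_iso A B ((x, y) :: s).
Proof.
move=> oB [sAB iso] Ax.
have [[p ps px]|nx] := pselect (exists2 p, p \in s & p.1 = x).
  exists p.2; rewrite -px -surjective_pairing; split=> [q|q q'].
    by rewrite inE => /orP[/eqP->|]; exact: sAB.
  by rewrite !inE => /orP[/eqP->|qs] /orP[/eqP->|q's]; exact: iso.
have [|||y [By Ly Uy]] := @order_like_between B
  [seq p.2 | p <- s & p.1 < x] [seq p.2 | p <- s & x < p.1] oB.
- by move=> _ /mapP[p + ->]; rewrite mem_filter => /andP[_ /sAB[]].
- by move=> _ /mapP[p + ->]; rewrite mem_filter => /andP[_ /sAB[]].
- move=> _ _ /mapP[p + ->] /mapP[q + ->].
  rewrite !mem_filter => /andP[px ps] /andP[xq qs].
  by rewrite -iso// (lt_trans px).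
have lo p : p \in s -> p.1 < x -> p.2 < y.
  by move=> ps px; apply: Ly; apply: map_f; rewrite mem_filter px.
have hi p : p \in s -> x < p.1 -> y < p.2.
  by move=> ps px; apply: Uy; apply: map_f; rewrite mem_filter px.
have cmp p : p \in s -> (p.1 < x /\ p.2 < y) \/ (x < p.1 /\ y < p.2).
  move=> ps; have [px|px|px] := ltgtP p.1 x.
  - by left; split=> //; exact: lo.
  - by right; split=> //; exact: hi.
  - by case: nx; exists p.
exists y; split=> [q|q q'].
  by rewrite inE => /orP[/eqP->|]; [|exact: sAB].
rewrite !inE => /orP[/eqP->|qs] /orP[/eqP->|q's] /=; rewrite ?ltxx//.
- have [[h1 h2]|[h1 h2]] := cmp _ q's; last by rewrite h1 h2.
  by rewrite !ltNge (ltW h1) (ltW h2).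
- have [[h1 h2]|[h1 h2]] := cmp _ qs; first by rewrite h1 h2.
  by rewrite !ltNge (ltW h1) (ltW h2).
- exact: iso.
Qed.

Lemma partial_iso_extendr A B s y : order_like A -> partial_iso A B s -> B y ->
  exists x, partial_iso A B ((x, y) :: s).
Proof.
move=> oA sAB By; have := partial_iso_extend oA (partial_iso_swap sAB) By.
move=> [x /partial_iso_swap]; rewrite /= /swap_pairs -map_comp map_id_in.
  by exists x.
by case.
Qed.

Lemma back_and_forth A B : countable A -> countable B ->
  order_like A -> order_like B ->
  exists P, [/\ isotone_rel P, (forall a b, P a b -> A a /\ B b),
    (forall a, A a -> exists b, P a b) & (forall b, B b -> exists a, P a b)].
Proof.
move=> cA cB oA oB.
have surj C : countable C -> order_like C ->
    exists e : nat -> R, (forall n, C (e n)) /\ (forall x, C x -> exists n, e n = x).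
  move=> cC [[c0 Cc0] _ _ _].
  have /countable_injP[f finj] := cC.
  pose e n := xget c0 [set x | C x /\ f x = n].
  have eC n : C (e n).
    rewrite /e; case: (xgetP c0 [set x | C x /\ f x = n]) => [x -> []//|_].
    exact: Cc0.
  exists e; split=> // x Cx; exists (f x); rewrite /e.
  case: (xgetP c0 [set x' | C x' /\ f x' = f x]) => [y -> [Cy fxy]|/(_ x)[]//].
  by apply: finj => //; rewrite inE.
have [a [aA asurj]] := surj A cA oA; have [b [bB bsurj]] := surj B cB oB.
have step n (s : {s | partial_iso A B s}) :
    {t : {t | partial_iso A B t} | [/\ {subset sval s <= sval t},
      (exists y, (a n, y) \in sval t) & (exists x, (x, b n) \in sval t)]}.
  apply: cid; case: s => s sP /=.
  have [y sy] := partial_iso_extend oB sP (aA n).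
  have [x sxy] := partial_iso_extendr oA sy (bB n).
  exists (exist _ _ sxy); split => /=.
  - by move=> p ps; rewrite !inE ps !orbT.
  - by exists y; rewrite !inE eqxx orbT.
  - by exists x; rewrite !inE eqxx.
have nilP : partial_iso A B [::] by split.
(* Passing to stage [m.+1] takes care of both the [m]-th point of [A] and the [m]-th point of [B],
   so the union of the chain is total and onto. *)
pose fix chain n : {s | partial_iso A B s} :=
  if n is m.+1 then sval (step m (chain m)) else exist _ _ nilP.
have chainS n m : (n <= m)%N -> {subset sval (chain n) <= sval (chain m)}.
  move=> /subnK <-; elim: (m - n)%N => // k IH p /IH.
  by rewrite addSn /=; case: (step _ _) => /= t [+ _ _]; apply.
exists (fun x y => exists n, (x, y) \in sval (chain n)); split.
- move=> x y x' y' [n xy] [m xy'].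
  have := svalP (chain (maxn n m)) => -[_ /(_ (x, y) (x', y'))]; apply.
    by apply: chainS xy; exact: leq_maxl.
  by apply: chainS xy'; exact: leq_maxr.
- by move=> x y [n xy]; have [/(_ _ xy)] := svalP (chain n).
- move=> x /asurj[n <-]; case E: (step n (chain n)) => [t [h1 [y yt] h3]].
  by exists y, n.+1; rewrite /= E.
- move=> x /bsurj[n <-]; case E: (step n (chain n)) => [t [h1 h2 [y yt]]].
  by exists y, n.+1; rewrite /= E.
Qed.

End BackAndForth.

Lemma order_iso_lt F G : order_iso F G -> {mono F : x y / x < y}.
Proof. by case=> _ _ /leW_mono. Qed.

Lemma order_iso_glue F1 G1 F2 G2 m : order_iso F1 G1 -> order_iso F2 G2 ->
  F1 m = F2 m ->
  exists F G, [/\ order_iso F G, (forall x, x <= m -> F x = F1 x) &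
    forall x, m <= x -> F x = F2 x].
Proof.
move=> iso1 iso2 eqm; have lt1 := order_iso_lt iso1; have lt2 := order_iso_lt iso2.
have [K1 K1' le1] := iso1; have [K2 K2' le2] := iso2.
exists (fun x => if x <= m then F1 x else F2 x),
  (fun y => if y <= F1 m then G1 y else G2 y).
split; last first.
- move=> x; rewrite le_eqVlt => /orP[/eqP <-|mx]; first by rewrite lexx.
  by rewrite leNgt mx.
- by move=> x ->.
split.
- move=> x; case: (leP x m) => xm; first by rewrite le1 xm K1.
  by rewrite eqm le2 leNgt xm K2.
- move=> y; case: (leP y (F1 m)) => ym; first by rewrite -(le1 (G1 y)) K1' ym.
  by rewrite leNgt -(lt2 m) K2' -eqm ym.
apply: le_mono => x y xy; case: (leP x m) => xm; case: (leP y m) => ym.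
- by rewrite lt1.
- by rewrite (le_lt_trans (y := F1 m))// ?le1// eqm lt2.
- by move: (lt_trans xm xy); rewrite ltNge ym.
- by rewrite lt2.
Qed.

(** * Isomorphisms of intervals that respect the marks *)

Section IntervalIso.
Variable D : set R.
Hypotheses (cD : countable D) (dD : `[0, 1] `<=` closure D).

Lemma dense_between x y : 0 <= x -> y <= 1 -> x < y -> exists2 d, D d & x < d < y.
Proof.
move=> x0 y1 xy; have /dD : `[0, 1]%classic ((x + y) / 2).
  by rewrite /= in_itv /=; apply/andP; split; lra.
have e0 : 0 < (y - x) / 2 by lra.
move=> /(_ _ (nbhsx_ballx _ _ e0))[d [Dd]].
rewrite /ball /= ltr_norml => /andP[h1 h2]; exists d => //.
by apply/andP; split; lra.
Qed.

Lemma order_like_interval p q : 0 <= p -> p < q -> q <= 1 ->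
  order_like (D `&` `]p, q[).
Proof.
move=> p0 pq q1; split.
- by have [d Dd] := dense_between p0 q1 pq; exists d; split=> //=; rewrite in_itv.
- move=> x []; rewrite /= in_itv /= => Dx /andP[px xq].
  have [|d Dd /andP[pd dx]] := dense_between p0 _ px; first by lra.
  by exists d => //; split=> //=; rewrite in_itv /=; apply/andP; split; lra.
- move=> x []; rewrite /= in_itv /= => Dx /andP[px xq].
  have [|d Dd /andP[pd dx]] := dense_between _ q1 xq; first by lra.
  by exists d => //; split=> //=; rewrite in_itv /=; apply/andP; split; lra.
move=> x y []; rewrite /= in_itv /= => Dx /andP[px xq] [].
rewrite /= in_itv /= => Dy /andP[py yq] xy.
have [||d Dd /andP[pd dx]] := dense_between _ _ xy; [lra|lra|].
exists d; last by apply/andP; split; lra.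
by split=> //=; rewrite in_itv /=; apply/andP; split; lra.
Qed.

(* Outside the two intervals the relation to be completed is a translation. *)
Lemma interval_iso p q p' q' : 0 <= p -> p < q -> q <= 1 ->
  0 <= p' -> p' < q' -> q' <= 1 ->
  exists F G, [/\ order_iso F G, F p = p', F q = q' &
    forall x, p < x < q -> D (F x) <-> D x].
Proof.
move=> p0 pq q1 p0' pq' q1'.
have oA := order_like_interval p0 pq q1; have oB := order_like_interval p0' pq' q1'.
have cI I : countable (D `&` I) by apply: sub_countable cD; apply: subset_card_le => ? [].
have [Q [isoQ QD domQ codQ]] := back_and_forth (cI _) (cI _) oA oB.
pose P x y := [\/ Q x y, x <= p /\ y = x - p + p' | q <= x /\ y = x - q + q'].
have QP x y : Q x y -> [/\ p < x, x < q, p' < y & y < q'].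
  by move=> /QD[[_ +] [_]]; rewrite /= !in_itv /= => /andP[? ?] /andP[? ?].
have isoP : isotone_rel P.
  move=> a b a' b'; case=> [Qab|[ap ->]|[qa ->]]; case=> [Qab'|[ap' ->]|[qa' ->]];
    try (have [? ? ? ?] := QP _ _ Qab); try (have [? ? ? ?] := QP _ _ Qab');
    try (by apply: isoQ);
    by apply/idP/idP => ?; lra.
have [||F [G [isoF FP]]] := isotone_rel_order_iso isoP.
- move=> x y xy; have [xp|px] := ltP x p.
    exists (Num.min ((x + y) / 2) p).
      by exists (Num.min ((x + y) / 2) p - p + p'); apply: Or32; rewrite ge_min lexx orbT.
    by rewrite lt_min xp gt_min; apply/andP; split; [|apply/orP; left]; lra.
  have [qy|yq] := ltP q y.
    exists (Num.max ((x + y) / 2) q).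
      by exists (Num.max ((x + y) / 2) q - q + q'); apply: Or33; rewrite le_max lexx orbT.
    by rewrite gt_max qy lt_max andbT; apply/andP; split; [apply/orP; left|]; lra.
  have [||d Dd /andP[xd dy]] := dense_between _ _ xy; [lra|lra|].
  have [|b Qdb] := domQ d; last by exists d; [exists b; apply: Or31|rewrite xd].
  by split=> //=; rewrite in_itv /=; apply/andP; split; lra.
- move=> x y xy; have [xp|px] := ltP x p'.
    exists (Num.min ((x + y) / 2) p').
      exists (Num.min ((x + y) / 2) p' - p' + p); apply: Or32.
      have : Num.min ((x + y) / 2) p' <= p' by rewrite ge_min lexx orbT.
      by split; lra.
    by rewrite lt_min xp gt_min; apply/andP; split; [|apply/orP; left]; lra.
  have [qy|yq] := ltP q' y.
    exists (Num.max ((x + y) / 2) q').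
      exists (Num.max ((x + y) / 2) q' - q' + q); apply: Or33.
      have : q' <= Num.max ((x + y) / 2) q' by rewrite le_max lexx orbT.
      by split; lra.
    by rewrite gt_max qy lt_max andbT; apply/andP; split; [apply/orP; left|]; lra.
  have [||d Dd /andP[xd dy]] := dense_between _ _ xy; [lra|lra|].
  have [|b Qdb] := codQ d; last by exists d; [exists b; apply: Or31|rewrite xd].
  by split=> //=; rewrite in_itv /=; apply/andP; split; lra.
exists F, G; split=> //.
- by apply: FP; apply: Or32; split; lra.
- by apply: FP; apply: Or33; split; lra.
move=> x /andP[px xq]; have Fp : F p = p' by apply: FP; apply: Or32; split; lra.
have Fq : F q = q' by apply: FP; apply: Or33; split; lra.
(* [F x] lies strictly between [p'] and [q'], where every mark has a partner under [Q]; injectivity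
   of [F] identifies this partner with [x]. *)
split=> [DF|Dx].
  have [|a Qa] := codQ (F x).
    split=> //=; rewrite in_itv /= -Fp -Fq !(order_iso_lt isoF).
    by rewrite px xq.
  have [/can_inj injF _ _] := isoF.
  rewrite -(injF _ _ (FP _ _ (Or31 _ _ Qa))).
  by have [[]] := QD _ _ Qa.
have [|b Qb] := domQ x; first by split=> //=; rewrite in_itv /= px.
by rewrite (FP _ _ (Or31 _ _ Qb)); have [_ []] := QD _ _ Qb.
Qed.

Hypothesis D01 : forall x, D x -> 0 < x.

(** [F] identifies a whole copy of T_0 with the part beyond [u] of another copy. Only (0, 1/2) is
    deformed, and it goes onto (u, 1/2), where all marks of T_0 are red. *)
Lemma swap_iso u : 0 < u < 1 / 2 ->
  exists F G, [/\ order_iso F G, F 0 = u, (forall x, 1 / 2 <= x -> F x = x) &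
    forall x, 0 < x -> D (F x) <-> D x].
Proof.
move=> /andP[u0 u1].
have [||||||F1 [G1 [iso1 F10 F11 DF1]]] := @interval_iso 0 (1 / 2) u (1 / 2);
  try by lra.
have [|||F [G [isoF le ge]]] := @order_iso_glue F1 G1 id id (1 / 2) => //.
exists F, G; split=> //; first by rewrite le//; lra.
move=> x x0; have [xh|xh] := leP (1 / 2) x; first by rewrite ge.
by rewrite le ?ltW//; apply: DF1; rewrite x0.
Qed.

(** Two interval isomorphisms, [0, u] onto [0, e] and [u, v] onto [e, v], are glued at [u] and
    continued by the identity. The gluing point has to go from mark to mark, hence [D e] and
    [D u]. *)
Lemma slide_iso e u v : D e -> D u -> e < u < v -> v <= 1 ->
  exists F G, [/\ order_iso F G, F 0 = 0, F u = e,
    (forall x, v <= x -> F x = x) & forall x, D (F x) <-> D x].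
Proof.
move=> De Du /andP[eu uv] v1; have e0 := D01 De; have u0 := D01 Du.
have [||||||F1 [G1 [iso1 F10 F11 DF1]]] := @interval_iso 0 u 0 e; try by lra.
have [||||||F2 [G2 [iso2 F20 F21 DF2]]] := @interval_iso u v e v; try by lra.
have [|||F3 [G3 [iso3 le3 ge3]]] := @order_iso_glue F2 G2 id id v => //.
have [|||F [G [iso le ge]]] := @order_iso_glue F1 G1 F3 G3 u => //.
  by rewrite F11 le3// ltW.
have F0 : F 0 = 0 by rewrite le// ltW.
exists F, G; split=> //.
- by rewrite le.
- by move=> x vx; rewrite ge ?ge3//; lra.
move=> x; have [x0|x0] := leP x 0.
  have Fx : F x <= 0 by rewrite -F0; case: iso => _ _ ->.
  by split=> /D01; rewrite ltNge ?Fx ?x0.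
have [->|xu] := eqVneq x u; first by rewrite le// F11.
have [xu'|ux] := ltP x u; first by rewrite le ?ltW//; apply: DF1; rewrite x0.
rewrite ge//; have [vx|xv] := leP v x; first by rewrite ge3.
by rewrite le3 ?ltW//; apply: DF2; rewrite xv andbT lt_neqAle eq_sym xu.
Qed.

End IntervalIso.
End OrderIso.

(** * Coherent coordinates and their transformations *)

Section Words.
Context {R : realType} (D : bool -> set R).
Implicit Types (t : R) (k b j : bool) (x : R * bool) (s : seq (R * bool)).
Implicit Types (f : seq (R * bool) -> R).

(** The kind of the arcs of the twig at a mark [t]: T_0 at a red point, T_1 at a green one. *)
Definition next_kind k t : bool := ~~ `[< red k t >].

(** A green twig is a single arc and gets the choice [false], so that each arc has exactly one
    address. *)
Definition letter k x : Prop := D k x.1 /\ (next_kind k x.1 -> x.2 = false).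

Fixpoint valid k s : Prop :=
  if s is x :: s' then letter k x /\ valid (next_kind k x.1) s' else True.

(** [coherent_parent] says that a point beyond the start of a twig arc projects to the attaching
    point on the arc below. Given this, [coherent_sibling] only has to separate the two arcs of a
    red twig. *)
Record coherent_tree f : Prop := CoherentTree {
  coherent_range : forall s, 0 <= f s <= 1;
  coherent_valid : forall s, f s != 0 -> valid false s;
  coherent_parent : forall s x, f (rcons s x) != 0 -> f s = x.1;
  coherent_sibling : forall s x y,
    f (rcons s x) != 0 -> f (rcons s y) != 0 -> x = y
}.

Lemma coherent_ge0 f s : coherent_tree f -> 0 <= f s.
Proof. by case=> /(_ s)/andP[]. Qed.

Lemma coherent_le1 f s : coherent_tree f -> f s <= 1.
Proof. by case=> /(_ s)/andP[]. Qed.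

Hypothesis hD : dense_marking D.

(** 0 is the breakpoint of index 0. *)
Lemma marking_gt0 k t : D k t -> 0 < t.
Proof.
move=> Dt; have := marking_sub hD Dt; rewrite /= in_itv /= => /andP[t0 _].
rewrite lt_neqAle t0 andbT eq_sym; apply/eqP => t00.
by apply: (marking_breakpoint hD (k := k) (n := 0)); rewrite /breakpoint mul0r -t00.
Qed.

Lemma marking_lt1 k t : D k t -> t < 1.
Proof.
move=> Dt; have := marking_sub hD Dt; rewrite /= in_itv /= => /andP[_ t1].
rewrite lt_neqAle t1 andbT; apply/eqP => t00.
by apply: (marking_one hD (k := k)); rewrite -t00.
Qed.

(** The breakpoints of index 0 and 1 are 0 and 1/2, and the even index 0 means red on T_0. *)
Lemma next_kind_half t : 0 < t < 1 / 2 -> next_kind false t = false.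
Proof.
move=> /andP[t0 t1]; apply/negbTE; rewrite negbK; apply/asboolP.
by exists 0%N; split=> //; rewrite /breakpoint mul0r t0 /= -[2%:R]/(2 : R).
Qed.

Lemma valid_cons_half t t' b s : D false t' -> t < 1 / 2 -> t' < 1 / 2 ->
  valid false ((t, b) :: s) -> valid false ((t', b) :: s).
Proof.
move=> Dt' th th' /= [[Dt _]]; have t0 := marking_gt0 Dt.
have t0' := marking_gt0 Dt'.
by rewrite /letter /= !next_kind_half ?t0 ?t0'.
Qed.

Lemma valid_branch u j s : D false u -> u < 1 / 2 ->
  valid false ((u, j) :: s) <-> valid false s.
Proof.
move=> Du uh; have u0 := marking_gt0 Du.
by rewrite /= /letter /= next_kind_half ?u0//; split=> [[]|].
Qed.

(** * Moving the root arc along itself *)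

Section Slide.
Variables F G : R -> R.
Hypotheses (isoF : order_iso F G) (F0 : F 0 = 0)
  (Fhalf : forall t, 1 / 2 <= t -> F t = t)
  (DF : forall t, D false (F t) <-> D false t).

(** The coordinates of the image of a point when the root arc is moved by [F] and the twigs travel
    along unchanged: what is attached at [t] afterwards was attached at [G t] before. *)
Definition slide f s : R :=
  if s is x :: s' then f ((G x.1, x.2) :: s') else F (f [::]).

Let FK : cancel F G. Proof. by case: isoF. Qed.
Let GK : cancel G F. Proof. by case: isoF. Qed.
Let leF : {mono F : x y / x <= y}. Proof. by case: isoF. Qed.
Let ltF := order_iso_lt isoF.
Let F_eq0 t : (F t == 0) = (t == 0).
Proof. by rewrite -{1}F0 (can_eq FK). Qed.

Lemma slide_valid t b s : valid false ((G t, b) :: s) -> valid false ((t, b) :: s).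
Proof.
move=> v; have [th|th] := leP (1 / 2) (G t).
  by move: v; rewrite -{2}[t]GK Fhalf.
have Ft : F (1 / 2) = 1 / 2 by rewrite Fhalf.
apply: (valid_cons_half _ _ _ v) => //; last by rewrite -[t]GK -Ft ltF.
by case: v => [[/DF]]; rewrite GK.
Qed.

Lemma slide_coherent f : coherent_tree f -> coherent_tree (slide f).
Proof.
move=> cf; split.
- case=> [|x s] /=; last exact: coherent_range.
  have F1 : F 1 = 1 by rewrite Fhalf//; lra.
  by rewrite -{1}F0 -[X in _ <= _ <= X]F1 !leF coherent_range.
- by case=> [//|[t b] s] /(coherent_valid cf)/slide_valid.
- move=> [|y s] x /=; last exact: (coherent_parent cf (s := _ :: s)).
  by move=> /(coherent_parent cf (s := [::])) ->; rewrite GK.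
- move=> [|z s] [t b] [t' b'] /= h h'; last exact: (coherent_sibling cf (s := _ :: s) h h').
  have [/(congr1 F) + ->] := coherent_sibling cf (s := [::]) h h'.
  by rewrite !GK => ->.
Qed.

Lemma slide_root f : slide f [::] = 0 <-> f [::] = 0.
Proof. by split=> [/eqP /=|/= ->//]; rewrite F_eq0 => /eqP. Qed.

End Slide.

Lemma slideK F G f : cancel F G -> slide G F (slide F G f) = f.
Proof.
by move=> FK; apply/funext => -[|[t b] s] /=; rewrite ?FK.
Qed.

(** * The exchange of two arcs as an involution of coherent families *)

Section Swap.
Variables (u : R) (j : bool) (F G : R -> R).
Hypotheses (Du : D false u) (uh : u < 1 / 2) (isoF : order_iso F G)
  (F0 : F 0 = u) (Fhalf : forall t, 1 / 2 <= t -> F t = t)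
  (DF : forall t, 0 < t -> D false (F t) <-> D false t).

(* Exchanges the part of the root arc beyond u with the twig arc (u, j). *)
Definition swap f s : R :=
  if s is x :: s1 then
    if x == (u, j) then
      if s1 is y :: s2 then
        if 0 < y.1 then f ((F y.1, y.2) :: s2) else 0
      else G (Num.max (f [::]) u)
    else if u < x.1 then f ((u, j) :: (G x.1, x.2) :: s1) else f s
  else Num.min (f [::]) u + F (f [:: (u, j)]) - u.

Let FK : cancel F G. Proof. by case: isoF. Qed.
Let GK : cancel G F. Proof. by case: isoF. Qed.
Let leF : {mono F : x y / x <= y}. Proof. by case: isoF. Qed.
Let ltF := order_iso_lt isoF.
Let Gu : G u = 0. Proof. by rewrite -F0 FK. Qed.
Let F1 : F 1 = 1. Proof. by rewrite Fhalf//; lra. Qed.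
Let Fh : F (1 / 2) = 1 / 2. Proof. by rewrite Fhalf. Qed.
Let u0 : 0 < u. Proof. exact: marking_gt0 Du. Qed.
Let gtu t : (u < F t) = (0 < t). Proof. by rewrite -{1}F0 ltF. Qed.
Let ltG t : (0 < G t) = (u < t). Proof. by rewrite -gtu GK. Qed.

Let branch0 f : coherent_tree f -> f [::] != u -> f [:: (u, j)] = 0.
Proof.
by move=> cf; apply: contra_neq_eq => /(coherent_parent cf (s := [::])).
Qed.

(** The sum in the definition of [swap] makes continuity evident; this is its meaning. If the root
    coordinate is not [u], the branch coordinate is 0 and [F 0 = u] cancels the subtracted [u]; if
    it is [u], only the [F] term remains. *)
Lemma swap_root f : coherent_tree f ->
  swap f [::] = if f [::] == u then F (f [:: (u, j)]) else Num.min (f [::]) u.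
Proof.
move=> cf /=; case: eqVneq => [->|fu]; first by rewrite minxx; lra.
by rewrite branch0// F0; lra.
Qed.

Lemma swap_root_nbranch f : f [:: (u, j)] = 0 -> swap f [::] = Num.min (f [::]) u.
Proof. by move=> /= ->; rewrite F0; lra. Qed.

Lemma swap_valid_out t b s : u < t ->
  valid false ((u, j) :: (G t, b) :: s) -> valid false ((t, b) :: s).
Proof.
move=> ut /valid_branch -/(_ Du uh) v.
have [th|th] := leP (1 / 2) (G t); first by move: v; rewrite -{2}[t]GK Fhalf.
apply: (valid_cons_half _ _ _ v) => //; last by rewrite -[t]GK -Fh ltF.
by case: v => [[+ _] _] /=; rewrite -(DF (t := G t)) ?ltG// GK.
Qed.

Lemma swap_valid_in t b s : 0 < t ->
  valid false ((F t, b) :: s) -> valid false ((u, j) :: (t, b) :: s).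
Proof.
move=> t0 v; apply/valid_branch => //.
have [th|th] := leP (1 / 2) t; first by move: v; rewrite Fhalf.
apply: (valid_cons_half _ _ _ v) => //; last by rewrite -Fh ltF.
by case: v => [[/(DF t0)]].
Qed.

Lemma swap_valid f s : coherent_tree f -> swap f s != 0 -> valid false s.
Proof.
move=> cf; case: s => [//|[t b] s]; rewrite [swap _ _]/=.
case: ((t, b) =P (u, j)) => [[-> ->]|tb].
  case: s => [|[t' b'] s] => [_|/=]; first exact/valid_branch.
  case: ifPn => [t0 |_]; last by rewrite eqxx.
  by move=> /(coherent_valid cf); exact: swap_valid_in.
case: ifPn => [ut|_]; last exact: coherent_valid.
by move=> /(coherent_valid cf); exact: swap_valid_out.
Qed.

Lemma swap_parent f s x : coherent_tree f ->
  swap f (rcons s x) != 0 -> swap f s = x.1.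
Proof.
move=> cf; case: s => [|y s]; first rewrite swap_root//.
  rewrite /=; case: (x =P (u, j)) => [-> h|xuj].
    have fu : u < f [::].
      rewrite ltNge; apply: contra_neqN h => fu.
      by rewrite (max_idPr fu).
    by rewrite gt_eqF// (min_idPr (ltW fu)).
  case: ifPn => [ux|]; rewrite ?leNgt => h.
    have e1 := coherent_parent cf (s := [:: (u, j)]) h.
    have /(coherent_parent cf (s := [::])) /= -> : f [:: (u, j)] != 0.
      by rewrite e1 /= gt_eqF// ltG.
    by rewrite eqxx e1 /= GK.
  move=> fx; have /= e1 := coherent_parent cf (s := [::]) fx.
  case: eqVneq => [e2|_]; last by rewrite e1; apply/min_idPl; rewrite leNgt.
  suff -> : f [:: (u, j)] = 0 by rewrite F0 -e2.
  apply: contra_not_eq xuj => h'.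
  exact: (coherent_sibling cf (s := [::]) fx h').
rewrite /=; case: ifPn => [_|_].
  case: s => [|z s] /=.
    case: ifPn => [x0|_]; last by rewrite eqxx.
    move=> /(coherent_parent cf (s := [::])) /= ->.
    by rewrite (max_idPl _) ?FK// ltW// gtu.
  case: ifPn => [x0|_]; last by rewrite eqxx.
  exact: (coherent_parent cf (s := _ :: s)).
case: ifPn => _; first exact: (coherent_parent cf (s := _ :: _ :: s)).
exact: (coherent_parent cf (s := _ :: s)).
Qed.

Lemma swap_sibling f s x y : coherent_tree f ->
  swap f (rcons s x) != 0 -> swap f (rcons s y) != 0 -> x = y.
Proof.
move=> cf; case: s => [|z s] hx hy.
  have e : x.1 = y.1 by rewrite -(swap_parent cf hx) (swap_parent cf hy).
  case: x y e hx hy => [t b] [_ b'] /= <-.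
  (* A nonzero coordinate on a twig arc at [u] puts the projection to the root arc at [u] itself, so
     there is no part beyond [u] to be moved to the branch. *)
  have conflict b1 : f [:: (u, b1)] != 0 -> G (Num.max (f [::]) u) != 0 -> False.
    move=> /(coherent_parent cf (s := [::])) /= ->.
    by rewrite maxxx Gu eqxx.
  case: ((t, b) =P (u, j)) => [[-> ->]|n1].
    case: ((u, b') =P (u, j)) => [[->]//|n2].
    by rewrite ltxx => h1 h2; case: (conflict _ h2 h1).
  case: ((t, b') =P (u, j)) => [[e1 e2]|n2].
    by rewrite e1 ltxx => h1 h2; case: (conflict _ h1 h2).
  case: ifPn => _ h1 h2; last exact: (coherent_sibling cf (s := [::]) h1 h2).
  by have [->] := coherent_sibling cf (s := [:: (u, j)]) h1 h2.
move: hx hy => /=; case: ifPn => [_|_].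
  case: s => [|z' s] /=.
    case: ifPn => [x0|_]; last by rewrite eqxx.
    case: ifPn => [y0 h1 h2|_]; last by rewrite eqxx.
    case: x y {x0 y0} h1 h2 => [t b] [t' b'] /= h1 h2.
    by have [/(can_inj FK)-> ->] := coherent_sibling cf (s := [::]) h1 h2.
  case: ifPn => [x0|_]; last by rewrite eqxx.
  exact: (coherent_sibling cf (s := _ :: s)).
case: ifPn => _; first exact: (coherent_sibling cf (s := _ :: _ :: s)).
exact: (coherent_sibling cf (s := _ :: s)).
Qed.

Lemma swap_coherent f : coherent_tree f -> coherent_tree (swap f).
Proof.
move=> cf; split; last 3 first.
- by move=> s; exact: swap_valid.
- by move=> s x; exact: swap_parent.
- by move=> s x y; exact: swap_sibling.
have f0 s := coherent_ge0 s cf; have f1 s := coherent_le1 s cf.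
case=> [|x s]; first rewrite swap_root//.
  case: ifPn => _.
    rewrite -[X in _ <= _ <= X]F1 leF f1 andbT.
    by apply: (le_trans (ltW u0)); rewrite -{1}F0 leF.
  by rewrite le_min f0 (ltW u0) ge_min f1.
rewrite /=; case: ifPn => _; last by case: ifPn => _; rewrite f0 f1.
case: s => [|y s]; last by case: ifPn => _; rewrite ?f0 ?f1// lexx ler01.
apply/andP; split; first by rewrite -leF F0 GK le_max lexx orbT.
by rewrite -leF F1 GK ge_max f1 /=; have := uh; lra.
Qed.

Lemma swap_root0 f : coherent_tree f -> swap f [::] = 0 <-> f [::] = 0.
Proof.
move=> cf; rewrite swap_root//; case: eqVneq => [->|fu].
  split=> [h|h]; last by move: u0; rewrite h ltxx.
  have : u <= F (f [:: (u, j)]) by rewrite -{1}F0 leF coherent_ge0.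
  by rewrite h leNgt u0.
split=> [|->]; last by apply/min_idPl; exact: ltW.
by case: (leP (f [::]) u) => // _ /eqP; rewrite gt_eqF.
Qed.

(** The exchange uses [F] in one direction and [G] in the other, so it is its own inverse. *)
Lemma swapK f : coherent_tree f -> swap (swap f) = f.
Proof.
move=> cf; have csf := swap_coherent cf; apply/funext => -[|[t b] s].
  rewrite swap_root// swap_root//= eqxx GK; case: (eqVneq (f [::]) u) => [fu|fu].
    rewrite fu maxxx; case: eqVneq => // Fu.
    have -> : Num.min (F (f [:: (u, j)])) u = u; last by [].
    by apply/min_idPr; rewrite -{1}F0 leF coherent_ge0.
  case: (leP (f [::]) u) => fu'; last by rewrite eqxx.
  by rewrite (negbTE fu); apply/min_idPl.
rewrite /=; case: ifPn => [/eqP[-> ->]|tb].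
  case: s => [|[t' b'] s] /=.
    have -> : Num.max (Num.min (f [::]) u + F (f [:: (u, j)]) - u) u =
        F (f [:: (u, j)]).
      have := swap_root cf; rewrite /= => ->; case: eqVneq => [_|fu].
        by apply/max_idPl; rewrite -{1}F0 leF coherent_ge0.
      rewrite branch0// F0; apply/max_idPr; rewrite ge_min lexx orbT //.
    by rewrite FK.
  (* The test [0 < y.1] in [swap] loses nothing: marks are positive, so a word with a nonpositive
     letter has coordinate 0. *)
  case: ifPn => [t0|]; last first.
    apply: contraNeq; rewrite eq_sym => /(coherent_valid cf)/=[_ [[]]].
    by move=> /marking_gt0.
  have n : (F t', b') != (u, j) by apply/eqP => -[e _]; move: t0; rewrite -gtu e ltxx.
  by rewrite (negbTE n) gtu t0 FK.
case: ifPn => [ut|ut]; last by rewrite (negbTE tb) (negbTE ut).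
by rewrite eqxx ltG ut GK.
Qed.

End Swap.
End Words.

Lemma order_iso_continuous (R : realType) (F G : R -> R) :
  order_iso F G -> continuous F.
Proof.
move=> isoF x; have ltF := order_iso_lt isoF; have [_ GK _] := isoF.
apply/cvgrPdist_lt => e e0.
have h1 : \forall y \near x, y < G (F x + e).
  by apply: lt_nbhsl; rewrite -ltF GK; lra.
have h2 : \forall y \near x, G (F x - e) < y.
  by apply: lt_nbhsr; rewrite -ltF GK; lra.
apply: filterS2 h1 h2 => y; rewrite -ltF GK => h1; rewrite -ltF GK => h2.
by rewrite ltr_distlC; apply/andP; split; lra.
Qed.

Section CoherentTree.
Context {R : realType} (D : bool -> set R).
Hypothesis hD : dense_marking D.
Implicit Types (s : seq (R * bool)) (f : seq (R * bool) -> R).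

Definition path_kind k s : bool := foldl (fun k (x : R * bool) => next_kind k x.1) k s.

Lemma valid_rcons k s x :
  valid D k (rcons s x) <-> valid D k s /\ letter D (path_kind k s) x.
Proof.
elim: s k => [|y s IH] k /=; first by split=> [[]|[]].
by rewrite IH; split=> [[? []]|[[]]].
Qed.

Lemma coherent_rcons f s x : coherent_tree D f -> f (rcons s x) != 0 -> f s != 0.
Proof.
move=> cf fs; rewrite (coherent_parent cf fs) gt_eqF//.
by have /valid_rcons[_ [/(marking_gt0 hD)]] := coherent_valid cf fs.
Qed.

Lemma coherent_cat f s s' : coherent_tree D f -> f (s ++ s') != 0 -> f s != 0.
Proof.
move=> cf; elim/last_ind: s' => [|s' x IH]; first by rewrite cats0.
by rewrite -rcons_cat => /(coherent_rcons cf).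
Qed.

(** By induction the words agree up to the last letter, which [coherent_sibling] settles. So a
    coherent tree is a single finite or infinite path of arcs. *)
Lemma coherent_unique f s s' : coherent_tree D f ->
  f s != 0 -> f s' != 0 -> size s = size s' -> s = s'.
Proof.
move=> cf; elim/last_ind: s s' => [|s x IH] s'; elim/last_ind: s' => [//|s' x' _];
  rewrite ?size_rcons// => fs fs' [ss'].
have e := IH _ (coherent_rcons cf fs) (coherent_rcons cf fs') ss'; subst s'.
by rewrite (coherent_sibling cf fs fs').
Qed.

Lemma coherent_const0 : coherent_tree D (fun=> 0).
Proof. by split=> [s|s|s x|s x y]; rewrite ?eqxx ?lexx ?ler01. Qed.

Lemma coherent_root0 f : coherent_tree D f -> f [::] = 0 -> f = fun=> 0.
Proof.
move=> cf f0; apply/funext => s; apply: contra_eq f0.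
exact: (coherent_cat (s := [::])).
Qed.

Definition coherent (xi : 'I_4 -> seq (R * bool) -> R) : Prop :=
  (forall i, coherent_tree D (xi i)) /\
  forall i j, xi i [::] != 0 -> xi j [::] != 0 -> i = j.

End CoherentTree.

(** * Ends coded by binary sequences *)

Section EndPath.
Context {R : realType} (D : bool -> set R).
Hypothesis hD : dense_marking D.
Variable c : R.
Hypotheses (Dc : D false c) (ch : c < 1 / 2).

Definition end_path (sigma : nat -> bool) n : seq (R * bool) :=
  mkseq (fun i => (c, sigma i)) n.
Arguments end_path : simpl never.

(** On every arc of its path the end projects to the next attaching point, which has parameter
    [c]. *)
Definition end_point sigma (i : 'I_4) s : R :=
  if (i == ord0) && (s == end_path sigma (size s)) then c else 0.

Lemma end_pathS sigma n : end_path sigma n.+1 = rcons (end_path sigma n) (c, sigma n).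
Proof. exact: mkseqS. Qed.

Lemma size_end_path sigma n : size (end_path sigma n) = n.
Proof. exact: size_mkseq. Qed.

Lemma end_path_cat sigma n m : (n <= m)%N ->
  exists s, end_path sigma m = end_path sigma n ++ s.
Proof.
move=> /subnKC <-; elim: (m - n)%N => [|k [s IH]].
  by exists [::]; rewrite addn0 cats0.
by exists (rcons s (c, sigma (n + k)%N)); rewrite addnS end_pathS IH rcons_cat.
Qed.

Lemma end_point_path sigma n : end_point sigma ord0 (end_path sigma n) = c.
Proof. by rewrite /end_point size_end_path !eqxx. Qed.

Lemma end_point_coherent sigma : coherent D (end_point sigma).
Proof.
have c0 := marking_gt0 hD Dc.
have nz i s : end_point sigma i s != 0 -> i = ord0 /\ s = end_path sigma (size s).
  by rewrite /end_point; case: andP => [[/eqP-> /eqP<-]|]; rewrite ?eqxx.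
split=> [i|i j /nz[-> _] /nz[-> _]//]; split.
- move=> s; rewrite /end_point; case: ifP => _; last by rewrite lexx ler01.
  by rewrite (ltW c0) ltW// (marking_lt1 hD Dc).
- move=> s /nz[_ ->]; rewrite /end_path /mkseq; elim: (iota _ _) => // k l IH.
  by apply/(valid_branch hD).
- move=> s x /nz[-> ]; rewrite size_rcons end_pathS => /rcons_inj[-> ->].
  by rewrite end_point_path.
move=> s x y /nz[_ ]; rewrite size_rcons end_pathS => /rcons_inj[_ ->] /nz[_].
by rewrite size_rcons end_pathS => /rcons_inj[_ ->].
Qed.

Lemma end_point_inj : injective end_point.
Proof.
move=> sigma tau st; apply/funext => k; apply: contrapT => skt.
have := end_point_path sigma k.+1; rewrite st /end_point size_end_path eqxx andTb.
case: eqP => [|_ /eqP]; last by rewrite lt_eqF// (marking_gt0 hD Dc).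
by rewrite !end_pathS => /rcons_inj[_ /skt].
Qed.

(** Each nonzero coordinate on the path forces the preceding one to be [c], and uniqueness at each
    depth makes all others 0. *)
Lemma end_point_eq sigma (xi : 'I_4 -> seq (R * bool) -> R) : coherent D xi ->
  (forall n, xi ord0 (end_path sigma n) != 0) -> xi = end_point sigma.
Proof.
move=> [cxi arm] nz; apply/funext => i; apply/funext => s; rewrite /end_point.
have [-> /=|i0 /=] := eqVneq i ord0; last first.
  have /(coherent_root0 hD (cxi i))-> : xi i [::] = 0; last by [].
  by apply: contra_neq_eq i0 => xi0; apply: arm xi0 (nz 0%N).
case: eqP => [->|ns].
  by have := nz (size s).+1; rewrite end_pathS => /(coherent_parent (cxi _)).
apply: contra_not_eq ns => fs.
by apply: (coherent_unique hD (cxi ord0)) => //; rewrite size_end_path.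
Qed.

Lemma end_path_leave sigma (xi : 'I_4 -> seq (R * bool) -> R) : coherent D xi ->
  xi <> end_point sigma ->
  exists n, forall m, (n <= m)%N -> xi ord0 (end_path sigma m) = 0.
Proof.
move=> cxi xin; apply: contrapT => /forallNP h; apply: xin.
apply: end_point_eq => // n; apply/negP => /eqP n0; apply: (h n) => m nm.
apply: contra_eq n0; have [s ->] := end_path_cat sigma nm.
by apply: (coherent_cat hD); case: cxi.
Qed.

End EndPath.

Arguments end_path {R} c sigma n : simpl never.

(** * Homeomorphisms from transformations of coordinates *)

Section Coordinates.
Context {R : realType} (D : bool -> set R).
Hypothesis hD : dense_marking D.
Context {X : topologicalType}.

(** All that the dynamical argument knows of the dendrite; [tower_coordinates] provides such an
    [r]. *)
Record coordinates (r : X -> 'I_4 -> seq (R * bool) -> R) : Prop := Coordinates {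
  coordinates_compact : compact [set: X];
  coordinates_continuous : forall i s, continuous (fun x => r x i s);
  coordinates_inj : injective r;
  coordinates_coherent : forall x, coherent D (r x);
  coordinates_surj : forall xi, coherent D xi -> exists x, r x = xi
}.

Variable r : X -> 'I_4 -> seq (R * bool) -> R.
Hypothesis hr : coordinates r.

(** If [F] did not converge to [z], its trace off a neighbourhood [U] of [z] would cluster at some
    [w] by compactness. The coordinates of [w] and [z] agree because the line is Hausdorff, so
    [w = z], a contradiction. *)
Lemma cvg_coordinates (F : set_system X) (z : X) : Filter F ->
  (forall i s, (fun x => r x i s) @ F --> r z i s) -> F --> z.
Proof.
move=> FF cv U zU; apply: contrapT => nFU.
have PG : ProperFilter (within (~` U) F).
  apply: Build_ProperFilter; rewrite /within => FA; apply: nFU; apply: (@filterS _ F _ _ _ _ FA) => x.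
  by move=> xA; apply: contrapT => /xA.
have [w [_ wG]] := coordinates_compact hr PG filterT.
suff wz : w = z.
  have [x [nUx Ux]] : (~` U) `&` U !=set0.
    by apply: wG; [exact: withinT|rewrite wz].
  exact: nUx.
apply: (coordinates_inj hr); apply/funext => i; apply/funext => s.
apply/esym/Rhausdorff => A B zA wB.
have [x [xA xB]] : ((fun x => r x i s) @^-1` A) `&` ((fun x => r x i s) @^-1` B) !=set0.
  apply: wG; first exact: (@cvg_within _ F FF (~` U) _ (cv i s A zA)).
  exact: (coordinates_continuous hr).
by exists (r x i s).
Qed.

Lemma continuous_coordinates (T : topologicalType) (h : T -> X) :
  (forall i s, continuous (fun x => r (h x) i s)) -> continuous h.
Proof. by move=> ch x; apply: cvg_coordinates => i s; exact: ch. Qed.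

Definition on_first_arm (tau : (seq (R * bool) -> R) -> seq (R * bool) -> R)
    (xi : 'I_4 -> seq (R * bool) -> R) (i : 'I_4) : seq (R * bool) -> R :=
  if i == ord0 then tau (xi ord0) else xi i.

(** [tree_map_root0] keeps points of the other arms off the first arm, so that still at most one arm
    has a nonzero root coordinate. *)
Record tree_map (tau : (seq (R * bool) -> R) -> seq (R * bool) -> R) : Prop :=
  TreeMap {
  tree_map_coherent : forall f, coherent_tree D f -> coherent_tree D (tau f);
  tree_map_root0 : forall f, coherent_tree D f -> f [::] = 0 -> tau f [::] = 0;
  tree_map_continuous : forall s, continuous (fun x => tau (r x ord0) s)
}.

Lemma tree_map_lift tau : tree_map tau ->
  exists2 h : X -> X, continuous h & forall x, r (h x) = on_first_arm tau (r x).
Proof.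
move=> tm; have ex x : exists y, r y = on_first_arm tau (r x).
  have [cx ax] := coordinates_coherent hr x; apply: (coordinates_surj hr); split.
    move=> i; rewrite /on_first_arm; case: eqP => // _.
    exact: tree_map_coherent.
  have nz i : on_first_arm tau (r x) i [::] != 0 -> r x i [::] != 0.
    rewrite /on_first_arm; case: (i =P ord0) => [->|//].
    by apply: contra_neq; exact: tree_map_root0.
  by move=> i j /nz xi /nz xj; exact: ax.
have [h hP] := choice ex; exists h => //.
apply: continuous_coordinates => i s; rewrite (_ : (fun _ => _) =
  fun x => on_first_arm tau (r x) i s); last by apply/funext => x; rewrite hP.
rewrite /on_first_arm; case: eqP => _; last exact: (coordinates_continuous hr).
exact: tree_map_continuous.
Qed.

Lemma tree_map_homeo tau tau' : tree_map tau -> tree_map tau' ->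
  (forall f, coherent_tree D f -> tau' (tau f) = f) ->
  (forall f, coherent_tree D f -> tau (tau' f) = f) ->
  exists2 h : X -> X, homeomorphism h & forall x, r (h x) = on_first_arm tau (r x).
Proof.
move=> tm tm' K K'.
have [h ch hP] := tree_map_lift tm; have [g cg gP] := tree_map_lift tm'.
have co x := (coordinates_coherent hr x).1 ord0.
exists h => //; split=> //; exists g; split=> // x; apply: (coordinates_inj hr).
  rewrite gP hP; apply/funext => i; rewrite /on_first_arm eqxx.
  by case: eqP => [->|//]; rewrite K.
rewrite hP gP; apply/funext => i; rewrite /on_first_arm eqxx.
by case: eqP => [->|//]; rewrite K'.
Qed.

Lemma slide_tree_map F G : order_iso F G -> F 0 = 0 ->
  (forall t, 1 / 2 <= t -> F t = t) ->
  (forall t, D false (F t) <-> D false t) -> tree_map (slide F G).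
Proof.
move=> isoF F0 Fh DF; split; first by move=> f; apply: (slide_coherent hD isoF).
  by move=> f cf f0; apply/(slide_root isoF).
case=> [|x s] /=; last exact: (coordinates_continuous hr).
move=> x; apply: continuous_comp; first exact: (coordinates_continuous hr).
exact: order_iso_continuous isoF _.
Qed.

Lemma slide_homeo F G : order_iso F G -> F 0 = 0 ->
  (forall t, 1 / 2 <= t -> F t = t) ->
  (forall t, D false (F t) <-> D false t) ->
  exists2 h : X -> X, homeomorphism h &
    forall x, r (h x) = on_first_arm (slide F G) (r x).
Proof.
move=> isoF F0 Fh DF; have [FK GK _] := isoF.
apply: (tree_map_homeo (tau' := slide G F) (slide_tree_map isoF F0 Fh DF)).
- apply: slide_tree_map; first exact: order_iso_sym.
  + by rewrite -{1}F0 FK.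
  + by move=> t th; rewrite -{1}(Fh t th) FK.
  + by move=> t; rewrite -{2}[t]GK DF.
- by move=> f _; exact: slideK.
by move=> f _; exact: slideK.
Qed.

Lemma swap_homeo u j F G : D false u -> u < 1 / 2 -> order_iso F G -> F 0 = u ->
  (forall t, 1 / 2 <= t -> F t = t) ->
  (forall t, 0 < t -> D false (F t) <-> D false t) ->
  exists2 h : X -> X, homeomorphism h &
    forall x, r (h x) = on_first_arm (swap u j F G) (r x).
Proof.
move=> Du uh isoF F0 Fh DF.
have cr := coordinates_continuous hr.
have tm : tree_map (swap u j F G).
  split; first by move=> f; apply: (swap_coherent hD j Du uh isoF).
    by move=> f cf f0; apply/(swap_root0 hD j Du isoF).
  case=> [|y [|z s]] x /=.
  - apply: cvgB; last exact: cvg_cst.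
    apply: cvgD.
      apply: (@continuous_min _ _ (fun x => r x ord0 [::]) (fun=> u)).
        exact: cr.
      exact: cvg_cst.
    apply: continuous_comp; first exact: cr.
    exact: order_iso_continuous isoF _.
  - case: (y == (u, j)); last by case: (u < y.1); exact: cr.
    apply: (@continuous_comp _ _ _ (fun x => Num.max (r x ord0 [::]) u) G); last first.
      exact: order_iso_continuous (order_iso_sym isoF) _.
    apply: (@continuous_max _ _ (fun x => r x ord0 [::]) (fun=> u)).
      exact: cr.
    exact: cvg_cst.
  - case: (y == (u, j)); last by case: (u < y.1); exact: cr.
    by case: (0 < z.1); [exact: cr|exact: cvg_cst].
by apply: (tree_map_homeo tm tm) => f cf; apply: (swapK hD j Du uh isoF).
Qed.

End Coordinates.

(** * The Ellis semigroup *)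

Lemma homeomorphism_id (X : topologicalType) : homeomorphism (@id X).
Proof. by split; [move=> ?; exact: cvg_id|exists id; split=> // ?; exact: cvg_id]. Qed.

Lemma homeomorphism_comp (X : topologicalType) (f g : X -> X) :
  homeomorphism f -> homeomorphism g -> homeomorphism (f \o g).
Proof.
move=> [cf [f' [cf' K1 K2]]] [cg [g' [cg' K3 K4]]].
split; first by move=> x; apply: continuous_comp; [exact: cg|exact: cf].
exists (g' \o f'); split; [by move=> x; apply: continuous_comp; [exact: cf'|exact: cg']| |].
- exact: can_comp.
- exact: can_comp.
Qed.

Section Collapse.
Context {R : realType} (D : bool -> set R).
Hypothesis hD : dense_marking D.
Context {X : topologicalType}.
Variable r : X -> 'I_4 -> seq (R * bool) -> R.
Hypothesis hr : coordinates D r.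
Variable c : R.
Hypotheses (Dc : D false c) (ch : c < 1 / 2).

Let co x : coherent_tree D (r x ord0).
Proof. by case: (coordinates_coherent hr x). Qed.

(* Swapping at c, then at the image of the next branching point, and so on,
   brings ever longer initial pieces of the end path onto the first arm. *)
Lemma straighten sigma n : exists (h : X -> X) (v : R),
  [/\ homeomorphism h, D false v, c <= v < 1 / 2,
      forall x i, i != ord0 -> r (h x) i = r x i &
      forall x s, r (h x) ord0 ((v, sigma n) :: s) =
        r x ord0 (end_path c sigma n.+1 ++ s)].
Proof.
elim: n => [|n [h [v [hh Dv /andP[cv vh] hi h0]]]].
  exists id, c; split=> //; first exact: homeomorphism_id.
  by rewrite lexx.
have [|F [G [isoF F0 Fh DF]]] :=
  @swap_iso _ _ (marking_countable hD false) (@marking_dense _ _ hD false) v.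
  by rewrite (marking_gt0 hD Dv).
have [g hg gP] := swap_homeo hD hr (sigma n) Dv vh isoF F0 Fh DF.
(* The swap at [v] puts the twig arc [(v, sigma n)] in place of the rest of the first arm, so its
   mark [c] lands at [F c], which is again below 1/2. *)
have vF : v < F c by rewrite -{1}F0 (order_iso_lt isoF) (marking_gt0 hD Dc).
exists (g \o h), (F c); split.
- exact: homeomorphism_comp.
- by rewrite DF// (marking_gt0 hD Dc).
- rewrite (le_trans cv (ltW vF)) /= -[X in _ < X](Fh (1 / 2)) ?lexx//.
  by rewrite (order_iso_lt isoF).
- by move=> x i i0; rewrite /= gP /on_first_arm (negbTE i0) hi.
move=> x s; rewrite (end_pathS _ _ n.+1) cat_rcons /= gP /on_first_arm eqxx /=.
have /negbTE-> : (F c, sigma n.+1) != (v, sigma n).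
  by apply/eqP => -[e _]; move: vF; rewrite e ltxx.
have [FK _ _] := isoF.
by rewrite vF FK h0.
Qed.

(** One more swap at [u] turns following the end path into thresholds on the first arm. A point with
    no nonzero coordinate on the twig arc there stays in [0, u]; one that also follows the next
    letter sits at the mark [c] of that twig arc, whose new position is [v = F c]. *)
Lemma straighten_split sigma n : exists (h : X -> X) (u v : R),
  [/\ homeomorphism h, D false u, c <= u < v, v < 1 / 2 &
      [/\ forall x i, i != ord0 -> r (h x) i = r x i,
      forall x, r x ord0 (end_path c sigma n.+1) = 0 -> r (h x) ord0 [::] <= u &
      forall x, r x ord0 (end_path c sigma n.+2) != 0 -> r (h x) ord0 [::] = v]].
Proof.
have [h [u [hh Du /andP[cu uh] hi h0]]] := straighten sigma n.
have [|F [G [isoF F0 Fh DF]]] :=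
  @swap_iso _ _ (marking_countable hD false) (@marking_dense _ _ hD false) u.
  by rewrite (marking_gt0 hD Du).
have [g hg gP] := swap_homeo hD hr (sigma n) Du uh isoF F0 Fh DF.
have vF : u < F c by rewrite -{1}F0 (order_iso_lt isoF) (marking_gt0 hD Dc).
have hu x : r (h x) ord0 [:: (u, sigma n)] = r x ord0 (end_path c sigma n.+1).
  by rewrite h0 cats0.
exists (g \o h), u, (F c); split=> //.
- exact: homeomorphism_comp.
- by rewrite cu.
- rewrite -[X in _ < X](Fh (1 / 2)) ?lexx//.
  by rewrite (order_iso_lt isoF).
split.
- by move=> x i i0; rewrite /= gP /on_first_arm (negbTE i0) hi.
- move=> x x0; rewrite /= gP /on_first_arm eqxx.
  by rewrite (swap_root_nbranch _ F0) ?hu// ge_min lexx orbT.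
move=> x xn; rewrite /= gP /on_first_arm eqxx.
have e : r (h x) ord0 [:: (u, sigma n)] = c.
  rewrite hu; move: xn; rewrite end_pathS => /(coherent_parent (co x)) //.
have c0 := marking_gt0 hD Dc.
rewrite (swap_root _ _ F0 (co (h x))).
have /(coherent_parent (co (h x)) (s := [::])) /= -> :
  r (h x) ord0 [:: (u, sigma n)] != 0 by rewrite e gt_eqF.
by rewrite eqxx e.
Qed.

(** A slide that fixes everything from [v] on carries [u] to a mark below [eps]: points that have
    left the end path are pressed against the origin, the others stay at [v]. The bound [c] depends
    on neither [n] nor [eps]. *)
Lemma collapse sigma n eps : 0 < eps -> exists h : X -> X,
  [/\ homeomorphism h,
      forall x i, i != ord0 -> r (h x) i = r x i,
      forall x, r x ord0 (end_path c sigma n.+1) = 0 -> r (h x) ord0 [::] <= eps &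
      forall x, r x ord0 (end_path c sigma n.+2) != 0 -> c <= r (h x) ord0 [::]].
Proof.
move=> e0; have [h [u [v [hh Du /andP[cu uv] vh [hi hlo hhi]]]]] := straighten_split sigma n.
have u0 := marking_gt0 hD Du.
have [|||e De] := @dense_between _ _ (@marking_dense _ _ hD false) 0 (Num.min eps u) => //.
- by rewrite ge_min; apply/orP; right; lra.
- by rewrite lt_min e0.
rewrite lt_min => /andP[e0' /andP[ee eu]].
have [||F [G [isoF F0 Fu Fv DF]]] := slide_iso (marking_countable hD false)
  (@marking_dense _ _ hD false) (marking_gt0 hD (k := false)) De Du (v := v).
- by rewrite eu.
- lra.
have Fh t : 1 / 2 <= t -> F t = t by move=> th; apply: Fv; lra.
have [g hg gP] := slide_homeo hD hr isoF F0 Fh DF.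
have [_ _ leF] := isoF.
exists (g \o h); split.
- exact: homeomorphism_comp.
- by move=> x i i0; rewrite /= gP /on_first_arm (negbTE i0) hi.
- move=> x /hlo xu; rewrite /= gP /on_first_arm eqxx /=.
  by apply: (le_trans (y := F u)); rewrite ?leF// Fu ltW.
move=> x /hhi xv; rewrite /= gP /on_first_arm eqxx /= xv Fv//; lra.
Qed.

Lemma end_point_ex sigma : exists x, r x = end_point c sigma.
Proof. by apply: (coordinates_surj hr); exact: end_point_coherent. Qed.

Definition endpt sigma : X := sval (cid (end_point_ex sigma)).

Lemma endptE sigma : r (endpt sigma) = end_point c sigma.
Proof. by rewrite /endpt; case: cid. Qed.

Definition nearly_collapsed (A : seq X) (eps : R) (h : X -> X) : Prop :=
  forall x, x \in A -> (forall i, i != ord0 -> r (h x) i = r x i) /\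
    r (h x) ord0 [::] <= eps.

(** Each of the finitely many points leaves the end path at some depth, and one depth beyond all of
    these serves the whole list. *)
Lemma collapse_finite sigma (A : seq X) eps : 0 < eps -> endpt sigma \notin A ->
  exists h, [/\ homeomorphism h, nearly_collapsed A eps h &
    c <= r (h (endpt sigma)) ord0 [::]].
Proof.
move=> e0 nA.
have [n nP] : exists n, forall x, x \in A -> r x ord0 (end_path c sigma n.+1) = 0.
  elim: A nA => [|y A IH]; first by exists 0%N.
  rewrite inE negb_or => /andP[ny /IH[n nP]].
  have [m mP] : exists m, forall k, (m <= k)%N -> r y ord0 (end_path c sigma k) = 0.
    apply: (end_path_leave hD (xi := r y)); first exact: (coordinates_coherent hr).
    by move=> yE; move/eqP: ny; apply; apply: (coordinates_inj hr); rewrite endptE.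
  exists (maxn m n) => x; rewrite inE => /orP[/eqP->|/nP xn].
    by apply: mP; rewrite (leq_trans (leq_maxl m n)).
  apply: contra_eq xn.
  have [s ->] := @end_path_cat _ c sigma n.+1 (maxn m n).+1 (leq_maxr m n).
  exact: (coherent_cat hD).
have [h [hh hi hlo hhi]] := collapse sigma n e0.
exists h; split=> //; first by move=> x /nP xA; split=> [i|]; [exact: hi|exact: hlo].
by apply: hhi; rewrite endptE end_point_path// gt_eqF// (marking_gt0 hD Dc).
Qed.

(** Cantor's diagonal argument against a numbering of the ends by [g]. *)
Lemma endpt_avoid (A : set X) : countable A -> exists sigma, ~ A (endpt sigma).
Proof.
move=> /countable_injP[g ginj]; apply: contrapT => /forallNP nA.
have {}nA s : A (endpt s) by apply: contrapT; exact: nA.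
pose code n := xget (fun=> false) [set s | g (endpt s) = n].
pose diag n := ~~ code n n.
have : code (g (endpt diag)) = diag.
  rewrite /code; case: xgetP => [s _ /= sd|/(_ diag)[]//].
  have /(congr1 r) : endpt s = endpt diag by apply: ginj; [exact/mem_set|exact/mem_set|exact: sd].
  by rewrite !endptE => /(end_point_inj hD Dc).
move: (g (endpt diag)) => n e; have : code n n = diag n by rewrite e.
by rewrite /diag; case: (code n n).
Qed.

Lemma collapsed_ex x : exists y,
  r y = fun i => if i == ord0 then fun=> 0 else r x i.
Proof.
apply: (coordinates_surj hr); have [cx ax] := coordinates_coherent hr x; split.
  by move=> i; case: eqP => // _; exact: coherent_const0.
move=> i j; case: (i =P ord0) => [_|_]; first by rewrite eqxx.
by case: (j =P ord0) => [_|_]; [rewrite eqxx|exact: ax].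
Qed.

Definition collapsed x : X := sval (cid (collapsed_ex x)).

Lemma collapsedE x : r (collapsed x) = fun i => if i == ord0 then fun=> 0 else r x i.
Proof. by rewrite /collapsed; case: cid. Qed.

(** The filter generated by the sets of homeomorphisms that nearly collapse a given finite list
    within a given tolerance; its convergence puts [collapsed] into the closure of the group. *)
Definition collapsing : set_system {ptws X -> X} := fun W =>
  exists (A : seq X) (eps : R), 0 < eps /\
    forall h, homeomorphism h -> nearly_collapsed A eps h -> W h.

Lemma collapsing_proper : ProperFilter collapsing.
Proof.
split.
  move=> [A [eps [e0 h0]]].
  have [|sigma nA] := @endpt_avoid [set` A].
    by apply: finite_set_countable; exact: finite_seq.
  have [|h [hh hA _]] := @collapse_finite sigma A eps e0; first exact/negP.
  exact: h0 hh hA.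
split.
- by exists [::], 1.
- move=> U V [A [e [e0 AU]]] [B [e' [e0' BV]]].
  exists (A ++ B), (Num.min e e'); split; first by rewrite lt_min e0.
  move=> h hh hAB; split; [apply: AU|apply: BV] => // x xA;
    have [|hi hle] := hAB x; rewrite ?mem_cat ?xA ?orbT//; split=> //;
    by apply: (le_trans hle); rewrite ge_min lexx ?orbT.
- move=> U V UV [A [e [e0 AU]]]; exists A, e; split=> // h hh hA.
  exact/UV/AU.
Qed.

Lemma collapsing_cvg : collapsing --> (collapsed : {ptws X -> X}).
Proof.
have FF := collapsing_proper.
apply/cvg_sup => x U [V] [[W oW <-] Wx WU].
apply: (filterS WU) => {WU U V}.
suff : (fun h : {ptws X -> X} => h x) @ collapsing --> collapsed x.
  by apply; exact: open_nbhs_nbhs.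
apply: (cvg_coordinates hr) => i s; rewrite collapsedE.
case: (i =P ord0) => [->|/eqP i0]; last first.
  move=> U /nbhs_singleton Ux; exists [:: x], 1; split=> // h _ /(_ x).
  by rewrite mem_head => /(_ isT)[hi _] /=; rewrite hi.
case: s => [|y s].
  apply/cvgrPdist_le => e e0; exists [:: x], e; split=> // h _ /(_ x).
  rewrite mem_head => /(_ isT)[_ hle]; rewrite /= sub0r normrN ger0_norm//.
  exact: (coherent_ge0 _ (co _)).
have [y0|y0] := leP y.1 0.
  move=> U /nbhs_singleton U0; exists [:: x], 1; split=> // h _ _ /=.
  suff -> : r (h x) ord0 (y :: s) = 0 by [].
  apply: contra_leP y0 => /eqP /(coherent_valid (co _)) /= [[Dy _] _].
  exact: (marking_gt0 hD Dy).
(* A root coordinate of at most half of [y.1] differs from [y.1], so by coherence all coordinates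
   beyond the letter [y] vanish. *)
move=> U /nbhs_singleton U0; exists [:: x], (y.1 / 2); split; first by lra.
move=> h _ /(_ x); rewrite mem_head => /(_ isT)[_ hle] /=.
suff -> : r (h x) ord0 (y :: s) = 0 by [].
apply: contra_leP hle => /eqP hn.
have /(coherent_parent (co _) (s := [::])) -> : r (h x) ord0 [:: y] != 0.
  exact: (coherent_cat hD (s' := s) (co _)).
lra.
Qed.

Lemma homeo_act_surj (h : X -> X) : homeomorphism h ->
  exists g : Homeo X, homeo_act g = h.
Proof.
move=> hh; have hm : h \in [set f : {compact-open, X -> X} | homeomorphism (f : X -> X)].
  by rewrite inE.
by exists (exist _ h hm).
Qed.

Let E := ellis (@homeo_act X).

Lemma ellis_homeo (h : X -> X) : homeomorphism h -> E h.
Proof. by move=> /homeo_act_surj[g <-]; apply: subset_closure; exists g. Qed.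

Lemma ellis_collapsed : E collapsed.
Proof.
move=> U /collapsing_cvg [A [e [e0 AU]]].
have [|sigma nA] := @endpt_avoid [set` A].
  by apply: finite_set_countable; exact: finite_seq.
have [|h [hh hA _]] := @collapse_finite sigma A e e0; first exact/negP.
exists h; split; last exact: AU.
by have [g <-] := homeo_act_surj hh; exists g.
Qed.

Theorem not_first_countable_ellis : ~ first_countable (set_type E).
Proof.
move=> fc; pose q : set_type E := exist _ collapsed (mem_set ellis_collapsed).
have [B cB [Bq Bbase]] := fc q.
(* For every member [V] of the base, a finite list and a tolerance that guarantee membership in [V];
   outside [B] the pair is a dummy. *)
have fam (V : set (set_type E)) : {A : seq X * R | B V ->
    0 < A.2 /\ forall h (Eh : E h), homeomorphism h -> nearly_collapsed A.1 A.2 h ->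
      V (exist _ h (mem_set Eh))}.
  apply: cid; have [BV|nBV] := pselect (B V); last by exists ([::], 0).
  have [W [[W' oW' WW'] Wq WV]] := Bq _ BV.
  have : collapsing W'.
    by apply: collapsing_cvg; apply: open_nbhs_nbhs; split=> //; move: Wq; rewrite -WW'.
  move=> [A [e [e0 AW]]]; exists (A, e) => _; split=> // h Eh hh hA.
  by apply: WV; rewrite -WW'; exact: AW.
have [sigma nA] : exists sigma, ~ (\bigcup_(V in B) [set` (sval (fam V)).1]) (endpt sigma).
  apply: endpt_avoid; apply: bigcup_countable => // V _.
  by apply: finite_set_countable; exact: finite_seq.
(* [collapsed] brings the avoided end to root coordinate 0, but the homeomorphisms of
   [collapse_finite] keep it at [c] or beyond, so no member of the base lies in [U]. *)
pose U := [set f : set_type E | r (set_val f (endpt sigma)) ord0 [::] < c].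
have c0 := marking_gt0 hD Dc.
have Uq : nbhs q U.
  have cv : continuous (fun f : set_type E => r (set_val f (endpt sigma)) ord0 [::]).
    move=> f; apply: (@continuous_comp _ _ _
      (fun f : set_type E => set_val f (endpt sigma)) (fun x => r x ord0 [::])).
      apply: (@continuous_comp _ {ptws X -> X} _ set_val (fun f => f (endpt sigma))).
        exact: initial_continuous.
      exact: proj_continuous.
    exact: (coordinates_continuous hr).
  have := cv q [set y : R | y < c]; apply; apply: lt_nbhsl.
  by rewrite set_valE /= collapsedE eqxx.
have [V BV VU] := Bbase _ Uq.
have [e0 fV] := svalP (fam V) BV.
have [|h [hh hA hc]] := @collapse_finite sigma (sval (fam V)).1 _ e0.
  by apply/negP => mA; apply: nA; exists V.
have := VU _ (fV h (ellis_homeo hh) hh hA).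
by rewrite /U /= ltNge hc.
Qed.

End Collapse.

(** * Arcs in the plane *)

Lemma within_comp (T U V : topologicalType) (A : set T) (B : set U)
    (f : T -> U) (g : U -> V) : {within A, continuous f} -> f @` A `<=` B ->
  {within B, continuous g} -> {within A, continuous (g \o f)}.
Proof.
move=> cf fAB cg; apply/subspace_continuousP => x Ax W Wg.
have Bfx : B (f x) by apply: fAB; exists x.
have Hg : nbhs (f x) [set u | B u -> W (g u)] :=
  proj1 (@subspace_continuousP U B V g) cg _ Bfx W Wg.
have Hf : nbhs x [set y | A y -> B (f y) -> W (g (f y))] :=
  proj1 (@subspace_continuousP T A U f) cf _ Ax _ Hg.
rewrite /= /fmap /= /within /=; apply: filterS Hf => y + Ay; apply=> //.
by apply: fAB; exists y.
Qed.

Lemma continuous_within_comp (T U V : topologicalType) (B : set U)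
    (f : T -> U) (g : U -> V) : continuous f -> (forall x, B (f x)) ->
  {within B, continuous g} -> continuous (g \o f).
Proof.
move=> cf fB cg x W Wg.
have Hg : nbhs (f x) [set u | B u -> W (g u)] :=
  proj1 (@subspace_continuousP U B V g) cg _ (fB x) W Wg.
have Hf : nbhs x [set y | B (f y) -> W (g (f y))] := cf x _ Hg.
by rewrite /= /fmap /=; apply: filterS Hf => y; apply; exact: fB.
Qed.

Lemma continuous_prod (T U V : topologicalType) (f : T -> U) (g : T -> V) :
  continuous f -> continuous g -> continuous (fun x => (f x, g x)).
Proof. by move=> cf cg x; exact: (cvg_pair (cf x) (cg x)). Qed.

(** Near a point off [Z], a small [K i] would bring its common point with [Z] too close. Hence only
    the finitely many large [K i] come near, and a finite union of closed sets is closed. *)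
Lemma closed_null_union (R : realType) (T : pseudoMetricType R) (I : choiceType)
    (J : set I) (Z : set T) (K : I -> set T) :
  closed Z -> (forall i, J i -> closed (K i)) ->
  (forall i, J i -> Z `&` K i !=set0) ->
  (forall eps : R, 0 < eps -> finite_set
     [set i | J i /\ ~ forall x y, K i x -> K i y -> ball x eps y]) ->
  closed (Z `|` \bigcup_(i in J) K i).
Proof.
move=> cZ cK ZK null p clp; apply: contrapT => /not_orP[nZ nK].
have [e e0 Ze] : exists2 e : R, 0 < e & ball p e `<=` ~` Z.
  have : nbhs p (~` Z) by apply: open_nbhs_nbhs; split=> //; exact: closed_openC.
  by rewrite -nbhs_ballE => -[e /= e0 eZ]; exists e.
set e2 := e / 2; have e20 : 0 < e2 by rewrite divr_gt0.
have fB := null _ e20; set Bad := [set i | _] in fB.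
have cB : closed (\bigcup_(i in Bad) K i).
  by apply: closed_bigcup => // i [Ji _]; exact: cK.
have nB : nbhs p (~` (\bigcup_(i in Bad) K i)).
  apply: open_nbhs_nbhs; split; first exact: closed_openC.
  by move=> [i [Ji _] Kp]; apply: nK; exists i.
have [y [yU [nyB py]]] := clp _ (filterI nB (nbhsx_ballx p e2 e20)).
have pe2 : ball p e2 `<=` ball p e.
  by apply: le_ball; rewrite /e2 ler_pdivrMr//; lra.
case: yU => [Zy|[i Ji Kiy]]; first exact: (Ze y (pe2 _ py)).
have [z [Zz Kz]] := ZK _ Ji; apply: (Ze z) => //.
have -> : e = e2 + e2 by rewrite /e2; lra.
apply: (ball_triangle py); have [//|nb] := pselect (ball y e2 z).
case: nyB; exists i => //; split=> // all; exact: nb (all _ _ Kiy Kz).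
Qed.

Section Arcs.
Context {R : realType}.
Local Notation plane := (R * R)%type.
Implicit Types (phi psi : R -> plane) (A C Y : set plane).

Lemma plane_hausdorff : hausdorff_space plane.
Proof. exact (@norm_hausdorff R (R * R)%type). Qed.

Lemma compact_plane_closed A : compact A -> closed A.
Proof. exact: (compact_closed plane_hausdorff). Qed.

Lemma closed_point (p : plane) : closed [set p].
Proof. apply: compact_plane_closed; exact: compact_set1. Qed.

Lemma parametrizes_compact phi A : parametrizes phi A -> compact A.
Proof.
by move=> [cphi _ <-]; apply: continuous_compact => //; exact: segment_compact.
Qed.

Lemma parametrizes_closed phi A : parametrizes phi A -> closed A.
Proof. by move=> /parametrizes_compact /compact_plane_closed. Qed.

Lemma parametrizes_mem phi A t : parametrizes phi A -> 0 <= t <= 1 -> A (phi t).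
Proof. by move=> [_ _ <-] t01; exists t; rewrite //= in_itv. Qed.

Lemma parametrizes_inj phi A s t : parametrizes phi A ->
  0 <= s <= 1 -> 0 <= t <= 1 -> phi s = phi t -> s = t.
Proof. by move=> [_ inj _] s01 t01; apply: inj; rewrite inE /= in_itv. Qed.

Lemma parametrizes_surj phi A p : parametrizes phi A -> A p ->
  exists2 t, 0 <= t <= 1 & phi t = p.
Proof. by move=> [_ _ <-] [t]; rewrite /= in_itv; exists t. Qed.

Definition param_inv phi (p : plane) : R :=
  xget 0 [set t | 0 <= t <= 1 /\ phi t = p].

Lemma param_invP phi A p : parametrizes phi A -> A p ->
  0 <= param_inv phi p <= 1 /\ phi (param_inv phi p) = p.
Proof.
move=> hA /(parametrizes_surj hA)[t t01 tp]; rewrite /param_inv.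
by case: xgetP => [s _ //|/(_ t)[]].
Qed.

Lemma param_invK phi A t : parametrizes phi A -> 0 <= t <= 1 ->
  param_inv phi (phi t) = t.
Proof.
move=> hA t01; have [i01 ip] := param_invP hA (parametrizes_mem hA t01).
exact: (parametrizes_inj hA i01 t01 ip).
Qed.

Lemma param_inv_continuous phi A : parametrizes phi A ->
  {within A, continuous (param_inv phi)}.
Proof.
move=> hA; have [cphi _ eA] := hA.
apply/continuous_closedP => W cW; apply/closed_subspaceP.
exists (phi @` (`[0, 1] `&` W)).
  apply: compact_plane_closed; apply: continuous_compact.
    by apply: continuous_subspaceW cphi => ? [].
  by apply: compact_closedI => //; exact: segment_compact.
apply/seteqP; split=> p /= [].
  move=> [t [+ Wt] <-] At; rewrite in_itv /= => t01; split=> //.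
  by rewrite /from_subspace (param_invK hA).
by move=> Wp Ap; split=> //; have [i01 ip] := param_invP hA Ap;
  exists (param_inv phi p); rewrite //= in_itv /=.
Qed.

Lemma arc_interior psi C : parametrizes psi C ->
  C `\` [set psi 0; psi 1] = psi @` `]0, 1[.
Proof.
move=> hC; apply/seteqP; split=> p /=.
  move=> [/(parametrizes_surj hC)[t /andP[t0 t1] <-] n]; exists t => //.
  rewrite in_itv /= !lt_neqAle t0 t1 !andbT.
  by apply/andP; split; apply/eqP => e; apply: n; [left; rewrite -e|right; rewrite e].
move=> [t + <-]; rewrite in_itv /= => /andP[t0 t1].
have t01 : 0 <= t <= 1 by rewrite !ltW.
split; first exact: (parametrizes_mem hC).
by case=> e; [move: t0|move: t1];
  rewrite (parametrizes_inj hC t01 _ e) ?lexx ?ler01 ?ltxx.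
Qed.

Record leg Y (p : plane) phi : Prop := Leg {
  leg_continuous : {within `[0, 1], continuous phi};
  leg_inj : set_inj `[0, 1] phi;
  leg_sub : forall t, 0 <= t <= 1 -> Y (phi t);
  leg_base : phi 0 = p
}.

(** As the interior of [C] is open in [Y], a short initial piece of the leg stays on [C] and can be
    read in the parameter of [psi]; by injectivity this parameter has changed at time [d]. *)
Lemma leg_on_arc Y C psi p phi : parametrizes psi C ->
  open (C `\` [set psi 0; psi 1] : set (subspace Y)) ->
  (C `\` [set psi 0; psi 1]) p -> leg Y p phi ->
  exists d, [/\ 0 < d <= 1, {within `[0, d], continuous (param_inv psi \o phi)},
    param_inv psi (phi d) != param_inv psi p &
    forall t, 0 <= t <= d -> C (phi t)].
Proof.
move=> hC /open_subspaceP[V oV VY] Cp [cphi iphi Yphi phi0].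
have Yp : Y p by rewrite -phi0; apply: Yphi; rewrite lexx ler01.
have Vp : V (phi 0).
  by rewrite phi0; have [] : (V `&` Y) p by rewrite VY; split.
have z01 : `[0, 1]%classic (0 : R) by rewrite /= in_itv /= lexx ler01.
have : nbhs (0 : R) [set t | `[0, 1]%classic t -> V (phi t)].
  exact: (proj1 (@subspace_continuousP _ _ _ phi) cphi _ z01 _ (open_nbhs_nbhs (conj oV Vp))).
rewrite -nbhs_ballE => -[e /= e0 eV].
pose d := Num.min (e / 2) 1.
have d0 : 0 < d by rewrite lt_min divr_gt0//= ltr01.
have d1 : d <= 1 by rewrite ge_min lexx orbT.
have de : d < e by rewrite gt_min; apply/orP; left; lra.
have dC t : 0 <= t <= d -> C (phi t).
  move=> /andP[t0 td]; have t1 : 0 <= t <= 1 by rewrite t0 (le_trans td).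
  have Vt : V (phi t).
    apply: eV; last by rewrite /= in_itv.
    by rewrite /ball /= sub0r normrN ger0_norm// (le_lt_trans td).
  have : (V `&` Y) (phi t) by split=> //; exact: Yphi.
  by rewrite VY => -[[]].
exists d; split=> //; first by rewrite d0.
- apply: (within_comp (B := C)); last exact: param_inv_continuous.
    apply: continuous_subspaceW cphi => t; rewrite /= !in_itv /= => /andP[-> td].
    exact: le_trans td d1.
  by move=> _ [t + <-]; rewrite /= in_itv; exact: dC.
apply/eqP => e'; have Cd : C (phi d) by apply: dC; rewrite lexx ltW.
have [_ k1] := param_invP hC Cd; have [_ k2] := param_invP hC Cp.1.
have : phi d = phi 0 by rewrite phi0 -k1 -k2 e'.
move=> /(iphi _ _ _ _); rewrite !inE /= !in_itv /= d1 (ltW d0) lexx ler01.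
by move=> /(_ isT isT) d00; move: d0; rewrite d00 ltxx.
Qed.

(** In the parameter of the free arc, two of three legs leave [p] towards the same side. By the
    intermediate value theorem both pass through a common point other than [p]. *)
Lemma no_triod Y C psi p (phi : 'I_3 -> R -> plane) : parametrizes psi C ->
  open (C `\` [set psi 0; psi 1] : set (subspace Y)) ->
  (forall k, leg Y p (phi k)) ->
  (forall k l s t, k != l -> 0 <= s <= 1 -> 0 <= t <= 1 ->
    phi k s = phi l t -> phi k s = p) ->
  ~ (C `\` [set psi 0; psi 1]) p.
Proof.
move=> hC oC lphi dis Cp.
have [d dP] := choice (fun k => leg_on_arc hC oC Cp (lphi k)).
pose f k t := param_inv psi (phi k t).
set s0 := param_inv psi p in dP; have f0 k : f k 0 = s0 by rewrite /f (leg_base (lphi k)).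
have p_s0 : psi s0 = p by have [] := param_invP hC Cp.1.
pose side k := s0 < f k (d k).
have [k [l [kl same]]] : exists k l, k != l /\ side k = side l.
  pose k0 : 'I_3 := inord 0; pose k1 : 'I_3 := inord 1; pose k2 : 'I_3 := inord 2.
  have n01 : k0 != k1 by apply/eqP => /(congr1 val); rewrite /= !inordK.
  have n02 : k0 != k2 by apply/eqP => /(congr1 val); rewrite /= !inordK.
  have n12 : k1 != k2 by apply/eqP => /(congr1 val); rewrite /= !inordK.
  case e0: (side k0); case e1: (side k1); case e2: (side k2);
  solve [ by exists k0, k1; rewrite e0 e1 | by exists k0, k2; rewrite e0 e2
        | by exists k1, k2; rewrite e1 e2].
have hit m v : Num.min s0 (f m (d m)) <= v <= Num.max s0 (f m (d m)) ->
    exists2 t, 0 <= t <= 1 & phi m t = psi v.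
  move=> vP; have [/andP[d0 d1] cm _ Cm] := dP m.
  have [|t] := IVT (ltW d0) cm (v := v); first by rewrite /= -/(f m 0) -/(f m _) f0.
  rewrite in_itv /= => /andP[t0 td] tv; exists t; first by rewrite t0 (le_trans td).
  have Ct : C (phi m t) by apply: Cm; rewrite t0.
  by have [_ <-] := param_invP hC Ct; rewrite -tv.
suff [v [vs0 vk vl]] : exists v, [/\ v != s0,
    Num.min s0 (f k (d k)) <= v <= Num.max s0 (f k (d k)) &
    Num.min s0 (f l (d l)) <= v <= Num.max s0 (f l (d l))].
  have [s s01 es] := hit _ _ vk; have [t t01 et] := hit _ _ vl.
  have pv : psi v = p by rewrite -es; apply: (dis k l s t kl) => //; rewrite es et.
  have Cv : C (psi v).
    by rewrite pv; case: Cp.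
  have [/andP[a0 a1] _ ak _] := dP k; have [/andP[b0 b1] _ bk _] := dP l.
  have inC m : 0 <= f m (d m) <= 1.
    have [/andP[c0 c1] _ _ Cm] := dP m.
    have Cd : C (phi m (d m)) by apply: Cm; rewrite lexx ltW.
    by have [] := param_invP hC Cd.
  have s01' : 0 <= s0 <= 1 by have [] := param_invP hC Cp.1.
  have v01 : 0 <= v <= 1.
    have := inC k; move: vk; rewrite ge_min le_max.
    move: s01' => /andP[? ?] /andP[/orP[?|?] /orP[?|?]] /andP[? ?];
    by apply/andP; split; lra.
  by move/eqP: vs0; apply; apply: (parametrizes_inj hC) => //; rewrite pv p_s0.
have nk m : f m (d m) != s0 by have [] := dP m.
have [sk|sk] := boolP (side k).
  have sl : side l by rewrite -same.
  rewrite /side in sk sl.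
  (* The nearer of the two parameters reached is passed by both legs. *)
  exists (Num.min (f k (d k)) (f l (d l))); split.
  - by rewrite gt_eqF// lt_min sk sl.
  - apply/andP; split; first by rewrite ge_min le_min (ltW sk) (ltW sl).
    by rewrite le_max !ge_min lexx !orbT.
  - apply/andP; split; first by rewrite ge_min le_min (ltW sk) (ltW sl).
    by rewrite le_max !ge_min lexx !orbT.
have lo m : ~~ side m -> f m (d m) < s0.
  by rewrite /side -leNgt lt_neqAle nk.
have lk := lo _ sk; have ll : f l (d l) < s0 by apply: lo; rewrite -same.
exists (Num.max (f k (d k)) (f l (d l))); split.
- by rewrite lt_eqF// gt_max lk ll.
- apply/andP; split; last by rewrite le_max ge_max (ltW lk) (ltW ll).
  by rewrite ge_min !le_max lexx !orbT.
- apply/andP; split; last by rewrite le_max ge_max (ltW lk) (ltW ll).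
  by rewrite ge_min !le_max lexx !orbT.
Qed.

End Arcs.

(** * A criterion for a family of arcs to consist of exactly the maximal free arcs *)

Section MaximalFreeArcs.
Context {R : realType}.
Local Notation plane := (R * R)%type.

Lemma arc_sub_closed (psi : R -> plane) C K : parametrizes psi C -> closed K ->
  C `\` [set psi 0; psi 1] `<=` K -> C `<=` K.
Proof.
move=> hC cK sub; have [cpsi _ eC] := hC.
have : closed (psi @^-1` K : set (subspace (`[0, 1]%classic : set R))).
  by move/continuous_closedP : cpsi; exact.
move=> /closed_subspaceP[V cV VK].
have oV : `]0, 1[ `<=` V.
  move=> t t01; have : (psi @^-1` K `&` `[0, 1]) t; last by rewrite -VK => -[].
  split; last exact: subset_itv_oo_cc t01.
  by apply: sub; rewrite (arc_interior hC); exists t.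
have ccV : `[0, 1] `<=` V.
  move=> t; rewrite /= in_itv /= => /andP[t0 t1]; apply: cV => W.
  rewrite -nbhs_ballE => -[e /= e0 eW].
  (* Moving [t] slightly towards the middle gives a point of (0, 1) within [e] of [t]. *)
  pose s := t + Num.min (e / 2) (1 / 2) * (1 / 2 - t).
  have m0 : 0 < Num.min (e / 2) (1 / 2) by rewrite lt_min; apply/andP; split; lra.
  have m1 : Num.min (e / 2) (1 / 2) <= e / 2 by rewrite ge_min lexx.
  have m2 : Num.min (e / 2) (1 / 2) <= 1 / 2 by rewrite ge_min lexx orbT.
  move: (Num.min _ _) @s m0 m1 m2 => m s m0 m1 m2.
  exists s; split.
    by apply: oV; rewrite /= in_itv /= /s; apply/andP; split; nra.
  by apply: eW; rewrite /ball /= /s ltr_distl; apply/andP; split; nra.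
move=> p Cp; have [t t01 <-] := parametrizes_surj hC Cp.
have t01' : `[0, 1]%classic t by rewrite /= in_itv.
have : (V `&` `[0, 1]) t by split=> //; exact: ccV.
by rewrite VK => -[].
Qed.

Variables (I : Type) (J : set I) (Y : set plane).
Variables (K : I -> set plane) (phi : I -> R -> plane).
Hypotheses (hK : forall i, J i -> parametrizes (phi i) (K i))
  (KY : forall i, J i -> K i `<=` Y)
  (closedK : forall i, J i -> closed (Y `\` (K i `\ phi i 0)))
  (sepK : forall i j p, J i -> J j -> K i p -> K j p -> i = j \/ p = phi i 0)
  (denseK : forall p, Y p -> (forall i, J i -> K i p -> p = phi i 0) ->
    closure [set phi i 0 | i in J] p)
  (branchK : forall C psi i, J i -> parametrizes psi C -> C `<=` Y ->
    open (C `\` [set psi 0; psi 1] : set (subspace Y)) ->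
    ~ (C `\` [set psi 0; psi 1]) (phi i 0)).

Lemma arc_free i : J i -> free_arc Y (K i).
Proof.
move=> Ji; split; first exact: KY.
exists (phi i 0), (phi i 1); split; first by exists (phi i); split=> //; exact: hK.
apply/open_subspaceP.
exists (~` (Y `\` (K i `\ phi i 0)) `&` ~` [set phi i 1]).
  by apply: openI; apply: closed_openC; [exact: closedK|exact: closed_point].
apply/seteqP; split=> p /=.
  move=> [[n n1] Yp]; split=> //; have [Kp n0] : (K i `\ phi i 0) p.
    by apply: contrapT => n'; apply: n.
  by split=> // -[].
move=> [[Kp n] Yp]; split=> //; split.
  by move=> [_]; apply; split=> // e; apply: n; left.
by move=> e; apply: n; right.
Qed.

(** No starting point is interior to [C], so by [denseK] every interior point lies on some [K i] off
    its start. The part of the interior on one [K i] is both open and closed in it, and the interior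
    is connected. *)
Lemma free_arc_sub C : free_arc Y C -> exists2 i, J i & C `<=` K i.
Proof.
move=> [CY [_ [_ [[psi [hC <- <-]] oC]]]]; set Co := C `\` _ in oC.
have CoE : Co = psi @` `]0, 1[ by exact: arc_interior.
have [V oV VY] := proj1 (@open_subspaceP _ Y Co) oC.
have cov p : Co p -> exists2 i, J i & K i p /\ p <> phi i 0.
  move=> Cp; apply: contrapT => n; have Yp : Y p by apply: CY; case: Cp.
  have clp : closure [set phi i 0 | i in J] p.
    apply: denseK => // i Ji Kip; apply: contrapT => pn; apply: n; exists i => //.
  have Vp : V p by have [] : (V `&` Y) p by rewrite VY; split.
  have [_ [[i Ji <-] Vi]] := clp V (open_nbhs_nbhs (conj oV Vp)).
  apply: (branchK Ji hC CY oC).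
  have : (V `&` Y) (phi i 0).
    split=> //; apply: (KY Ji); apply: (parametrizes_mem (hK Ji)).
    by rewrite lexx ler01.
  by rewrite VY => -[].
have Cm : Co (psi (1 / 2)).
  by rewrite CoE; exists (1 / 2) => //; rewrite /= in_itv /=; apply/andP; split; lra.
have [i Ji [Kim mi]] := cov _ Cm; exists i => //.
have nbranch : ~ Co (phi i 0) by exact: branchK.
have conn : connected Co.
  rewrite CoE; apply: connected_continuous_connected.
    exact/connected_intervalP/interval_is_interval.
  by case: hC => cpsi _ _; apply: continuous_subspaceW cpsi; exact: subset_itv_oo_cc.
have e : Co `&` (K i `\ phi i 0) = Co.
  apply: conn.
  - by exists (psi (1 / 2)); split=> //; split.
  - exists (~` (Y `\` (K i `\ phi i 0))); first exact/closed_openC/closedK.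
    apply/seteqP; split=> p [Cp] => [Kp|n]; split=> //; first by case.
    apply: contrapT => n'; apply: n; split=> //; apply: CY; by case: Cp.
  - exists (K i); first exact: parametrizes_closed (hK Ji).
    apply/seteqP; split=> p [Cp] => [[]//|Kp]; split=> //; split=> //= pe.
    by apply: nbranch; rewrite -pe.
apply: (arc_sub_closed hC); first exact: parametrizes_closed (hK Ji).
by rewrite -/Co -e => p [_ []].
Qed.

(** A larger free arc lies in some [K j], which then contains the far end [phi i 1]; this is not the
    start of [K i], so [sepK] gives [i = j]. *)
Lemma maximal_free_arcP C : maximal_free_arc Y C <-> exists2 i, J i & C = K i.
Proof.
split=> [[fC max]|[i Ji ->]].
  have [i Ji CK] := free_arc_sub fC; exists i => //.
  by apply: max => //; exact: arc_free.
split; first exact: arc_free.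
move=> B /free_arc_sub[j Jj BK] KB; apply/seteqP; split=> //.
suff -> : i = j by [].
have p1 : 0 <= (1 : R) <= 1 by rewrite lexx ler01.
have p0 : 0 <= (0 : R) <= 1 by rewrite lexx ler01.
have Ki1 := parametrizes_mem (hK Ji) p1.
have [//|/(parametrizes_inj (hK Ji) p1 p0)/eqP] := sepK Ji Jj Ki1 (BK _ (KB _ Ki1)).
by rewrite oner_eq0.
Qed.

End MaximalFreeArcs.

Section Diameter.
Context {R : realType}.
Local Notation plane := (R * R)%type.
Implicit Types (A : set plane).

Lemma edist_ge (p q : plane) : `|p.1 - q.1| <= Defs.edist p q /\ `|p.2 - q.2| <= Defs.edist p q.
Proof.
by split; rewrite /Defs.edist -sqrtr_sqr ler_sqrt ?lerDl ?lerDr ?addr_ge0 ?sqr_ge0.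
Qed.

Lemma diam_ge A p q : compact A -> A p -> A q -> Defs.edist p q <= diam A.
Proof.
move=> cA Ap Aq; apply: ub_le_sup; last by exists p => //; exists q.
have [M [_ MA]] := compact_bounded cA.
pose B := `|M| + 1.
have B0 : 0 <= B by rewrite addr_ge0.
have AB x : A x -> `|x.1| <= B /\ `|x.2| <= B.
  move=> Ax; have : `|x| <= B.
    by apply: MA => //; rewrite /B (le_lt_trans (ler_norm _))// ltrDl.
  by rewrite /Num.norm /= ge_max => /andP[].
exists (Num.sqrt ((2 * B) ^+ 2 + (2 * B) ^+ 2)) => _ [x /AB[x1 x2]] [y /AB[y1 y2]] <-.
have sq (a b : R) : `|a| <= B -> `|b| <= B -> (a - b) ^+ 2 <= (2 * B) ^+ 2.
  move=> aB bB; rewrite -[X in X <= _]real_normK ?num_real//.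
  rewrite ler_sqr ?nnegrE ?mulr_ge0//.
  by apply: (le_trans (ler_normB _ _)); lra.
by rewrite /Defs.edist ler_sqrt ?addr_ge0 ?sqr_ge0// lerD ?sq.
Qed.

Lemma diam_ball A p q (e : R) : compact A -> diam A < e -> A p -> A q -> ball p e q.
Proof.
move=> cA dA Ap Aq; have pq := diam_ge cA Ap Aq; have [h1 h2] := edist_ge p q.
by split; apply: le_lt_trans dA; [exact: le_trans h1 pq|exact: le_trans h2 pq].
Qed.

End Diameter.

(** * Coordinates on the limit of a tower *)

Section Colours.
Context {R : realType} (D : bool -> set R).
Hypothesis hD : dense_marking D.

Lemma breakpoint_cvg (t : R) : t < 1 -> exists n, t < breakpoint R n.
Proof.
move=> t1; have e0 : 0 < 1 - t by lra.
pose n := (Num.truncn (1 - t)^-1); exists n.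
have n0 : 0 < n.+1%:R :> R by rewrite ltr0n.
have : (1 - t)^-1 < n.+1%:R by exact: truncnS_gt.
rewrite -[X in X < _]div1r ltr_pdivrMr// => h.
rewrite /breakpoint ltr_pdivlMr//.
by move: h; rewrite -[n.+1%:R]natr1; lra.
Qed.

Lemma marking_colour k t : D k t -> red k t \/ green k t.
Proof.
move=> Dt; have t0 := marking_gt0 hD Dt; have t1 := marking_lt1 hD Dt.
have [n nt nmin] := ex_minnP (breakpoint_cvg t1).
case: n nt nmin => [|n] nt nmin.
  by move: nt; rewrite /breakpoint mul0r ltNge (ltW t0).
have bt : breakpoint R n < t.
  rewrite lt_neqAle; apply/andP; split.
    by apply/eqP => e; apply: (marking_breakpoint hD (k := k) (n := n)); rewrite e.
  by rewrite leNgt; apply/negP => /nmin; rewrite ltnn.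
have [e|e] := eqVneq (odd n) k; [left|right]; exists n; rewrite bt nt; split=> //.
by move: e; case: (odd n); case: (k).
Qed.

Lemma next_kind_green k t : D k t -> next_kind k t -> green k t.
Proof. by move=> /marking_colour[r|//]; rewrite /next_kind => /negP; case; exact/asboolP. Qed.

End Colours.

Section Tower.
Context {R : realType} (D : bool -> set R) (S : tower R).
Hypotheses (hD : dense_marking D) (hS : dendrite_tower D S).
Local Notation plane := (R * R)%type.
Local Notation rword := (seq (R * bool)).

Variables (o : plane) (A0 : 'I_4 -> set plane).
Hypothesis base : [/\ forall k, copy_from S 0 false (A0 k) o,
  forall k l, k != l -> A0 k `&` A0 l = [set o] & stage S 0 = \bigcup_k A0 k].

Lemma red_arcs_ex i a : exists AB : set plane * set plane, red_points D S i a ->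
  [/\ copy_from S i.+1 false AB.1 a, copy_from S i.+1 false AB.2 a,
      AB.1 `&` AB.2 = [set a] & twig S i a = AB.1 `|` AB.2].
Proof.
have [/(tower_red hS)[A [B AB]]|n] := pselect (red_points D S i a).
  by exists (A, B).
by exists (set0, set0).
Qed.

Definition red_arcs i a : set plane * set plane := sval (cid (red_arcs_ex i a)).

Lemma red_arcsP i a : red_points D S i a ->
  [/\ copy_from S i.+1 false (red_arcs i a).1 a,
      copy_from S i.+1 false (red_arcs i a).2 a,
      (red_arcs i a).1 `&` (red_arcs i a).2 = [set a] &
      twig S i a = (red_arcs i a).1 `|` (red_arcs i a).2].
Proof. by rewrite /red_arcs; case: cid. Qed.

(* From here on words are read backwards: the head is the last letter. *)
Fixpoint kindr (l : rword) : bool :=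
  if l is x :: l' then next_kind (kindr l') x.1 else false.

Fixpoint validr (l : rword) : Prop :=
  if l is x :: l' then validr l' /\ letter D (kindr l') x else True.

Lemma kindr_rev s : kindr (rev s) = path_kind false s.
Proof.
elim/last_ind: s => // s x IH.
by rewrite rev_rcons /= IH /path_kind foldl_rcons.
Qed.

Lemma validr_rev s : validr (rev s) <-> valid D false s.
Proof.
elim/last_ind: s => [//|s x IH]; rewrite rev_rcons /= IH kindr_rev.
by rewrite valid_rcons.
Qed.

Fixpoint arc (j : 'I_4) (l : rword) : set plane :=
  if l is x :: l' then
    let a := chart S (size l') (arc j l') x.1 in
    if next_kind (kindr l') x.1 then twig S (size l') a
    else if x.2 then (red_arcs (size l') a).2 else (red_arcs (size l') a).1
  else A0 j.

Definition warc (w : 'I_4 * rword) := arc w.1 w.2.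
Definition wchart (w : 'I_4 * rword) := chart S (size w.2) (warc w).
Definition wstart (w : 'I_4 * rword) := wchart w 0.
Definition level i : set ('I_4 * rword) := [set w | validr w.2 /\ size w.2 = i].
Definition child (w : 'I_4 * rword) x : 'I_4 * rword := (w.1, x :: w.2).

(** The invariant of the induction on stages. [wp_max] makes the attaching points of X_i computable
    from addresses; [wp_dense] supplies the density of starting points needed to recognize the
    maximal free arcs of X_(i+1). *)
Record well_placed i : Prop := WellPlaced {
  wp_kind : forall w, level i w -> kind S i (warc w) = kindr w.2;
  wp_chart : forall w, level i w -> parametrizes (wchart w) (warc w);
  wp_max : forall C, maximal_free_arc (stage S i) C <->
    exists2 w, level i w & C = warc w;
  wp_compact : compact (stage S i);
  wp_sub : forall w, level i w -> warc w `<=` stage S i;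
  wp_closed : forall w, level i w ->
    closed (stage S i `\` (warc w `\ wstart w));
  wp_sep : forall w w' p, level i w -> level i w' -> warc w p -> warc w' p ->
    w = w' \/ p = wstart w;
  wp_dense : stage S i `<=` closure (attaching_points D S i)
}.

Lemma arc_dense i w : level i w -> parametrizes (wchart w) (warc w) ->
  warc w `<=` closure [set wchart w t | t in D (kindr w.2)].
Proof.
move=> Jw hw p wp; have [t t01 <-] := parametrizes_surj hw wp.
have t01' : `[0, 1]%classic t by rewrite /= in_itv.
move=> W Wt; have [cw _ _] := hw.
have N : nbhs t [set s | `[0, 1]%classic s -> W (wchart w s)] :=
  proj1 (@subspace_continuousP _ _ _ (wchart w)) cw _ t01' _ Wt.
have [s [Ds sW]] := @marking_dense _ _ hD (kindr w.2) t t01' _ N.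
exists (wchart w s); split; first by exists s.
by apply: sW; exact: (marking_sub hD Ds).
Qed.

(** * From one stage to the next *)

Section Level.
Variable i : nat.
Hypothesis wp : well_placed i.

Lemma red_pointsP a : red_points D S i a <->
  exists w t, [/\ level i w, D (kindr w.2) t, red (kindr w.2) t & a = wchart w t].
Proof.
split=> [[A [t [/(wp_max wp)[w Jw ->]]]]|[w [t [Jw Dt rt ->]]]].
  rewrite (wp_kind wp Jw) => Dt rt ->; exists w, t; split=> //.
  by rewrite /wchart; case: Jw => _ ->.
exists (warc w), t; rewrite (wp_kind wp Jw); split=> //.
  by apply/(wp_max wp); exists w.
by rewrite /wchart; case: Jw => _ ->.
Qed.

Lemma green_pointsP a : green_points D S i a <->
  exists w t, [/\ level i w, D (kindr w.2) t, green (kindr w.2) t & a = wchart w t].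
Proof.
split=> [[A [t [/(wp_max wp)[w Jw ->]]]]|[w [t [Jw Dt rt ->]]]].
  rewrite (wp_kind wp Jw) => Dt rt ->; exists w, t; split=> //.
  by rewrite /wchart; case: Jw => _ ->.
exists (warc w), t; rewrite (wp_kind wp Jw); split=> //.
  by apply/(wp_max wp); exists w.
by rewrite /wchart; case: Jw => _ ->.
Qed.

Lemma attaching_pointsP a : attaching_points D S i a <->
  exists w t, [/\ level i w, D (kindr w.2) t & a = wchart w t].
Proof.
split=> [[/red_pointsP|/green_pointsP] [w [t [Jw Dt _ ->]]]|[w [t [Jw Dt ->]]]].
- by exists w, t.
- by exists w, t.
have [c|c] := marking_colour hD Dt; [left; apply/red_pointsP|right; apply/green_pointsP];
by exists w, t.
Qed.

Lemma marking_le01 k t : D k t -> 0 <= t <= 1.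
Proof. by move=> Dt; rewrite (ltW (marking_gt0 hD Dt)) (ltW (marking_lt1 hD Dt)). Qed.

Lemma wchart_start w t : level i w -> 0 <= t <= 1 -> wchart w t = wstart w -> t = 0.
Proof.
move=> Jw t01; apply: (parametrizes_inj (wp_chart wp Jw)) => //.
by rewrite lexx ler01.
Qed.

Lemma wchart_eq w w' t t' : level i w -> level i w' -> 0 < t <= 1 -> 0 < t' <= 1 ->
  wchart w t = wchart w' t' -> w = w' /\ t = t'.
Proof.
move=> Jw Jw' /andP[t0 t1] /andP[t0' t1'] e.
have t01 : 0 <= t <= 1 by rewrite ltW.
have t01' : 0 <= t' <= 1 by rewrite ltW.
have wt := parametrizes_mem (wp_chart wp Jw) t01.
have wt' := parametrizes_mem (wp_chart wp Jw') t01'.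
rewrite -e in wt'.
have [ww|/(wchart_start Jw t01) tz] := wp_sep wp Jw Jw' wt wt'.
  split=> //; move: e; rewrite -ww.
  exact: (parametrizes_inj (wp_chart wp Jw)).
by move: t0; rewrite tz ltxx.
Qed.

Lemma level_child w x : level i w -> letter D (kindr w.2) x -> level i.+1 (child w x).
Proof. by move=> [vw sw] lx; split=> //=; rewrite sw. Qed.

Lemma level_succ w' : level i.+1 w' -> exists w x,
  [/\ level i w, letter D (kindr w.2) x & w' = child w x].
Proof.
by case: w' => j [|x l] [] //= [vl lx] [sl]; exists (j, l), x.
Qed.

Lemma child_arcE w x : level i w -> warc (child w x) =
  if next_kind (kindr w.2) x.1 then twig S i (wchart w x.1)
  else if x.2 then (red_arcs i (wchart w x.1)).2 else (red_arcs i (wchart w x.1)).1.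
Proof. by move=> [_ <-]. Qed.

Lemma child_red w t : level i w -> D (kindr w.2) t -> ~~ next_kind (kindr w.2) t ->
  red_points D S i (wchart w t).
Proof.
move=> Jw Dt; rewrite negbK => /asboolP rt.
by apply/red_pointsP; exists w, t.
Qed.

Lemma child_copy w x : level i w -> letter D (kindr w.2) x ->
  copy_from S i.+1 (kindr (child w x).2) (warc (child w x)) (wchart w x.1).
Proof.
move=> Jw [Dx _]; rewrite child_arcE//= -/(kindr w.2).
case: ifPn => nk.
  by apply: (tower_green hS); apply/green_pointsP; exists w, x.1; split=> //;
    exact: (next_kind_green hD Dx nk).
have [c1 c2 _ _] := red_arcsP (child_red Jw Dx nk).
by case: (x.2).
Qed.

(** [L] is the other arc of a red twig, or the attaching point alone for a green one. *)
Lemma child_rest w x : level i w -> letter D (kindr w.2) x ->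
  exists L, [/\ closed L, L (wchart w x.1),
    twig S i (wchart w x.1) = warc (child w x) `|` L &
    warc (child w x) `&` L `<=` [set wchart w x.1]].
Proof.
move=> Jw lx; have [Dx xb] := lx; have [_ hc c0] := child_copy Jw lx.
have wa : warc (child w x) (wchart w x.1).
  by rewrite -c0; apply: (parametrizes_mem hc); rewrite lexx ler01.
move: wa; rewrite child_arcE//; case: ifPn => nk wa.
  exists [set wchart w x.1]; split; [exact: closed_point|by []| |by move=> p []].
  by apply/seteqP; split=> p; [left|case=> // ->].
have rp := child_red Jw Dx nk.
have [[_ c1 e1] [_ c2 e2] AB ->] := red_arcsP rp.
have m1 : (red_arcs i (wchart w x.1)).1 (wchart w x.1).
  by rewrite -[X in _ X]e1; apply: (parametrizes_mem c1); rewrite lexx ler01.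
have m2 : (red_arcs i (wchart w x.1)).2 (wchart w x.1).
  by rewrite -[X in _ X]e2; apply: (parametrizes_mem c2); rewrite lexx ler01.
case: (x.2).
  exists (red_arcs i (wchart w x.1)).1; split=> //; last by rewrite setIC AB.
    exact: parametrizes_closed c1.
  by rewrite setUC.
exists (red_arcs i (wchart w x.1)).2; split=> //; last by rewrite AB.
exact: parametrizes_closed c2.
Qed.

Lemma child_sub w x : level i w -> letter D (kindr w.2) x ->
  warc (child w x) `<=` twig S i (wchart w x.1).
Proof. by move=> Jw lx; have [L [_ _ -> _]] := child_rest Jw lx; left. Qed.

Lemma twig_cover w t p : level i w -> D (kindr w.2) t -> twig S i (wchart w t) p ->
  exists2 b, letter D (kindr w.2) (t, b) & warc (child w (t, b)) p.
Proof.
move=> Jw Dt; have [nk tp|nk] := boolP (next_kind (kindr w.2) t).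
  by exists false => //; rewrite child_arcE//= nk.
have [_ _ _ ->] := red_arcsP (child_red Jw Dt nk); case=> Ap.
  by exists false => //; rewrite child_arcE//= (negbTE nk).
exists true; first by split=> //= nk'; rewrite nk' in nk.
by rewrite child_arcE//= (negbTE nk).
Qed.

Lemma child_sep w t b b' p : level i w -> letter D (kindr w.2) (t, b) ->
  letter D (kindr w.2) (t, b') -> warc (child w (t, b)) p ->
  warc (child w (t, b')) p -> b = b' \/ p = wchart w t.
Proof.
move=> Jw [/= Dt bP] [/= _ bP']; rewrite !child_arcE//=.
case: ifPn => nk; first by left; rewrite (bP nk) (bP' nk).
have [_ _ AB _] := red_arcsP (child_red Jw Dt nk).
case: b {bP} => A1; case: b' {bP'} => A2; try (by left); right.
  have : ((red_arcs i (wchart w t)).1 `&` (red_arcs i (wchart w t)).2) p by split.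
  by rewrite AB.
have : ((red_arcs i (wchart w t)).1 `&` (red_arcs i (wchart w t)).2) p by split.
by rewrite AB.
Qed.

Lemma attaching_child w x : level i w -> letter D (kindr w.2) x ->
  attaching_points D S i (wchart w x.1).
Proof. by move=> Jw [Dx _]; apply/attaching_pointsP; exists w, x.1. Qed.

Lemma attaching_stage a : attaching_points D S i a -> stage S i a.
Proof.
move=> /attaching_pointsP[w [t [Jw Dt ->]]]; apply: (wp_sub wp Jw).
exact: (parametrizes_mem (wp_chart wp Jw) (marking_le01 Dt)).
Qed.

Lemma child_stage w x p : level i w -> letter D (kindr w.2) x ->
  warc (child w x) p -> stage S i p -> p = wchart w x.1.
Proof.
move=> Jw lx cp sp; have ax := attaching_child Jw lx.
have : (stage S i `&` twig S i (wchart w x.1)) p.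
  by split=> //; exact: child_sub cp.
by rewrite (tower_meet hS ax).
Qed.

Lemma twig_base a : attaching_points D S i a -> twig S i a a.
Proof.
move=> aa; have : [set a] a by [].
by rewrite -(tower_meet hS aa) => -[].
Qed.

Lemma twig_compact a : attaching_points D S i a -> compact (twig S i a).
Proof.
move=> [/red_arcsP[[_ c1 _] [_ c2 _] _ ->]|/(tower_green hS)[_ c _]].
  by apply: compactU; [exact: parametrizes_compact c1|exact: parametrizes_compact c2].
exact: parametrizes_compact c.
Qed.

Lemma twig_null (e : R) : 0 < e -> finite_set [set a | attaching_points D S i a /\
  ~ forall p q, twig S i a p -> twig S i a q -> ball p e q].
Proof.
move=> e0; apply: (@sub_finite_set _ _
  [set a | attaching_points D S i a /\ e / 2 < diam (twig S i a)]); last first.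
  by apply: (tower_null hS); lra.
move=> a [aa nb]; split=> //; rewrite ltNge; apply/negP => de; apply: nb => p q.
by apply: diam_ball; [exact: twig_compact|lra].
Qed.

Lemma twig_unique a b p : attaching_points D S i a -> attaching_points D S i b ->
  twig S i a p -> twig S i b p -> a = b.
Proof.
move=> aa ab ap bp; apply/eqP; apply/negP => /negP ne.
have := tower_disjoint hS aa ab ne; rewrite -subset0 => /(_ p); exact.
Qed.

Let z01 : 0 <= (0 : R) <= 1. Proof. by rewrite lexx ler01. Qed.

Lemma chart_leg j w : level j w -> parametrizes (wchart w) (warc w) ->
  forall Y, warc w `<=` Y -> leg Y (wstart w) (wchart w).
Proof.
move=> Jw hw Y wY; have [c inj _] := hw; split=> // t t01.
exact/wY/(parametrizes_mem hw).
Qed.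

Lemma affine_leg w a d Y : level i w -> warc w `<=` Y -> d != 0 ->
  (forall s, 0 <= s <= 1 -> 0 <= a + d * s <= 1) ->
  leg Y (wchart w a) (fun s => wchart w (a + d * s)).
Proof.
move=> Jw wY d0 as01; have hw := wp_chart wp Jw; have [c _ _] := hw; split.
- apply: (@within_comp R R _ _ `[0, 1]%classic (fun s => a + d * s) (wchart w)) => //.
    apply: continuous_subspaceT => s; apply: cvgD; first exact: cvg_cst.
    by apply: cvgM; [exact: cvg_cst|exact: cvg_id].
  by move=> _ [s + <-]; rewrite /= !in_itv; exact: as01.
- move=> s t; rewrite !inE /= !in_itv /= => s01 t01.
  move=> /(parametrizes_inj hw (as01 _ s01) (as01 _ t01)).
  by move=> /addrI /(mulfI d0).
- by move=> s s01; exact/wY/(parametrizes_mem hw)/as01.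
by rewrite mulr0 addr0.
Qed.

(* At a branching point: the two halves of the arc and one twig arc. *)
Lemma attaching_branch w x C psi : level i w -> letter D (kindr w.2) x ->
  parametrizes psi C -> C `<=` stage S i.+1 ->
  open (C `\` [set psi 0; psi 1] : set (subspace (stage S i.+1))) ->
  ~ (C `\` [set psi 0; psi 1]) (wchart w x.1).
Proof.
move=> Jw lx hC CY oC; set t := x.1; set a := wchart w t.
have Dx : D (kindr w.2) t by case: lx.
have t0 := marking_gt0 hD Dx; have t1 := marking_lt1 hD Dx.
have hw := wp_chart wp Jw.
have [_ hc c0] := child_copy Jw lx.
have stS : stage S i `<=` stage S i.+1 by rewrite (tower_step hS) => p; left.
have wY : warc w `<=` stage S i.+1 by move=> p /(wp_sub wp Jw)/stS.
have cY : warc (child w x) `<=` stage S i.+1.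
  rewrite (tower_step hS) => p /(child_sub Jw lx) tp; right.
  by exists (wchart w x.1) => //; exact: attaching_child.
pose legs (k : 'I_3) := if val k == 0%N then (fun s => wchart w (t + (1 - t) * s))
  else if val k == 1%N then (fun s => wchart w (t + (- t) * s))
  else chart S i.+1 (warc (child w x)).
have up01 s : 0 <= s <= 1 -> 0 <= t + (1 - t) * s <= 1.
  by move=> /andP[? ?]; apply/andP; split; nra.
have dn01 s : 0 <= s <= 1 -> 0 <= t + (- t) * s <= 1.
  by move=> /andP[? ?]; apply/andP; split; nra.
apply: (@no_triod _ (stage S i.+1) C psi a legs hC oC).
  move=> k; rewrite /legs; case: ifPn => _; last case: ifPn => _.
  - by apply: affine_leg => //; rewrite subr_eq0 gt_eqF.
  - by apply: affine_leg => //; rewrite oppr_eq0 gt_eqF.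
  rewrite /a -c0; case: Jw (Jw) => _ sw Jw.
  have [c inj _] := hc; split=> // s s01; exact/cY/(parametrizes_mem hc).
have meet s s' : 0 <= s <= 1 -> 0 <= s' <= 1 ->
    chart S i.+1 (warc (child w x)) s = wchart w s' -> wchart w s' = a.
  move=> s01 s01' e; rewrite /a; apply: (child_stage Jw lx).
    by rewrite -e; exact: (parametrizes_mem hc).
  exact/(wp_sub wp Jw)/(parametrizes_mem hw).
have two s s' : 0 <= s <= 1 -> 0 <= s' <= 1 ->
    wchart w (t + (1 - t) * s) = wchart w (t + (- t) * s') ->
    wchart w (t + (1 - t) * s) = a.
  move=> s01 s01' /(parametrizes_inj hw (up01 _ s01) (dn01 _ s01')) e.
  move: s01 s01' => /andP[? ?] /andP[? ?].
  suff -> : s = 0 by rewrite mulr0 addr0.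
  by nra.
move=> k l s s' kl s01 s01'; rewrite /legs.
have := ltn_ord k; have := ltn_ord l; move: kl; rewrite -val_eqE /=.
move: (val k) (val l) => m n.
case: m => [|[|[|//]]] /=; case: n => [|[|[|//]]] //= _ _ _ e.
- exact: (two s s').
- by apply: (meet s') => //; exact: up01.
- by rewrite e; apply: (two s' s).
- by apply: (meet s') => //; exact: dn01.
- by rewrite e; apply: (meet s) => //; exact: up01.
- by rewrite e; apply: (meet s) => //; exact: dn01.
Qed.

Lemma child_wchart w x : level i w -> letter D (kindr w.2) x ->
  parametrizes (wchart (child w x)) (warc (child w x)) /\
  wstart (child w x) = wchart w x.1.
Proof.
move=> Jw lx; have [_ hc c0] := child_copy Jw lx.
have e : wchart (child w x) = chart S i.+1 (warc (child w x)) by case: Jw => _ <-.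
by rewrite /wstart e.
Qed.

Lemma marked_attaching j w t : level j w -> kind S j (warc w) = kindr w.2 ->
  maximal_free_arc (stage S j) (warc w) -> D (kindr w.2) t ->
  attaching_points D S j (wchart w t).
Proof.
move=> [_ sw] kw mw Dt; rewrite /wchart sw.
by have [c|c] := marking_colour hD Dt; [left|right];
  exists (warc w), t; rewrite kw.
Qed.

Let wpC : closed (stage S i).
Proof. apply: compact_plane_closed; exact: (wp_compact wp). Qed.

Lemma stage_succ_closed : closed (stage S i.+1).
Proof.
rewrite (tower_step hS); apply: closed_null_union => //.
- by move=> a aa; apply: compact_plane_closed; exact: twig_compact.
- by move=> a aa; exists a; split; [exact: attaching_stage|exact: twig_base].
exact: twig_null.
Qed.

Lemma stage_succ_compact : compact (stage S i.+1).
Proof.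
have [M [_ MA]] := compact_bounded (wp_compact wp).
pose B := `|M| + 2.
apply: (@subclosed_compact _ _ (`[- B, B]%classic `*` `[- B, B]%classic)).
- exact: stage_succ_closed.
- by apply: compact_setX; exact: segment_compact.
have box p : stage S i p -> `|p.1| <= `|M| + 1 /\ `|p.2| <= `|M| + 1.
  move=> sp; have : `|p| <= `|M| + 1.
    by apply: MA => //; rewrite (le_lt_trans (ler_norm _))// ltrDl.
  by rewrite /Num.norm /= ge_max => /andP[].
have M0 : 0 <= `|M| by [].
have inB (u v : R) : `|u| <= `|M| + 1 -> `|u - v| < 1 -> `[- B, B]%classic v.
  rewrite /= in_itv /= ler_norml ltr_norml /B => /andP[? ?] /andP[? ?].
  by apply/andP; split; lra.
rewrite (tower_step hS) => p [/box[p1 p2]|[a aa tp]].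
  by split; [apply: (inB p.1)|apply: (inB p.2)] => //; rewrite subrr normr0.
have [a1 a2] := box _ (attaching_stage aa).
have d1 : diam (twig S i a) < 1.
  apply: lt_le_trans (tower_small hS aa) _.
  by rewrite invf_le1 ?exprn_gt0// exprn_ege1// ler1n.
have [b1 b2] := diam_ball (twig_compact aa) d1 (twig_base aa) tp.
by split; [apply: (inB a.1)|apply: (inB a.2)].
Qed.

Lemma level_succ_sub w' : level i.+1 w' -> warc w' `<=` stage S i.+1.
Proof.
move=> /level_succ[w [x [Jw lx ->]]] p cp; rewrite (tower_step hS); right.
by exists (wchart w x.1); [exact: attaching_child|exact: child_sub cp].
Qed.

(** Removing [Q] affects one twig only, of which the closed set [L] remains; the complement is again
    X_i with a null family of closed sets attached. *)
Lemma level_succ_closed w' : level i.+1 w' ->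
  closed (stage S i.+1 `\` (warc w' `\ wstart w')).
Proof.
move=> /level_succ[w [x [Jw lx ->]]].
have [_ ->] := child_wchart Jw lx; set a := wchart w x.1.
have aa : attaching_points D S i a by exact: attaching_child.
set Q := warc _ `\ a.
have nQ p : stage S i p -> ~ Q p by move=> sp [cp]; apply; exact: (child_stage Jw lx).
have -> : stage S i.+1 `\` Q =
    stage S i `|` \bigcup_(b in attaching_points D S i) (twig S i b `\` Q).
  rewrite (tower_step hS); apply/seteqP; split=> p.
    by move=> [[sp|[b ab tp]] nq]; [left|right; exists b].
  move=> [sp|[b ab [tp nq]]]; first by split; [left|exact: nQ].
  by split=> //; right; exists b.
apply: closed_null_union => //.
- move=> b ab; have [e|ne] := pselect (b = a).
    have [L [cL La tE AL]] := child_rest Jw lx.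
    suff -> : twig S i b `\` Q = L by [].
    rewrite e tE; apply/seteqP; split=> p.
      move=> [[cp|//] nq]; have -> : p = a by apply: contrapT => pa; apply: nq; split.
      exact: La.
    by move=> Lp; split; [right|move=> [cp]; apply; apply: AL].
  suff -> : twig S i b `\` Q = twig S i b.
    apply: compact_plane_closed; exact: twig_compact.
  apply/seteqP; split=> p; first by case.
  move=> tp; split=> // -[cp _]; apply: ne; apply: (twig_unique ab aa tp).
  exact: (child_sub Jw lx).
- move=> b ab; exists b; split; first exact: attaching_stage.
  by split; [exact: twig_base|exact/nQ/attaching_stage].
move=> e e0; apply: sub_finite_set (twig_null e0) => b [ab n]; split=> // all.
by apply: n => p q [tp _] [tq _]; exact: all.
Qed.

Lemma level_succ_sep w1 w2 p : level i.+1 w1 -> level i.+1 w2 ->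
  warc w1 p -> warc w2 p -> w1 = w2 \/ p = wstart w1.
Proof.
move=> /level_succ[u1 [[t1 b1] [J1 l1 ->]]] /level_succ[u2 [[t2 b2] [J2 l2 ->]]] c1 c2.
have [_ ->] := child_wchart J1 l1.
have e : wchart u1 t1 = wchart u2 t2.
  apply: (twig_unique (attaching_child J1 l1) (attaching_child J2 l2) (p := p)).
    exact: (child_sub J1 l1).
  exact: (child_sub J2 l2).
have D1 : D (kindr u1.2) t1 by case: l1.
have D2 : D (kindr u2.2) t2 by case: l2.
have r1 : 0 < t1 <= 1 by rewrite (marking_gt0 hD D1) (ltW (marking_lt1 hD D1)).
have r2 : 0 < t2 <= 1 by rewrite (marking_gt0 hD D2) (ltW (marking_lt1 hD D2)).
have [eu et] := wchart_eq J1 J2 r1 r2 e; subst u2 t2.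
by have [->|pe] := child_sep J1 l1 l2 c1 c2; [left|right].
Qed.

Lemma stage_succ_cover p : stage S i.+1 p -> stage S i p \/
  exists w', level i.+1 w' /\ warc w' p.
Proof.
rewrite (tower_step hS) => -[sp|[a aa tp]]; [by left|right].
move: aa tp => /(attaching_pointsP)[w [t [Jw Dt ->]]] tp.
have [b lb cp] := twig_cover Jw Dt tp.
by exists (child w (t, b)); split=> //; exact: level_child.
Qed.

Lemma level_succ_max C : maximal_free_arc (stage S i.+1) C <->
  exists2 w', level i.+1 w' & C = warc w'.
Proof.
apply: (@maximal_free_arcP _ _ (level i.+1) (stage S i.+1) warc wchart).
- by move=> w' /level_succ[w [x [Jw lx ->]]]; have [] := child_wchart Jw lx.
- exact: level_succ_sub.
- exact: level_succ_closed.
- exact: level_succ_sep.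
- move=> p /stage_succ_cover sp n.
  (* The new arcs start at the attaching points of X_i, which are dense in X_i; this settles
     [denseK] for the points of X_i. *)
  have starts : attaching_points D S i `<=` [set wchart w' 0 | w' in level i.+1].
    move=> _ /attaching_pointsP[w [t [Jw Dt ->]]].
    have [b lb _] := twig_cover Jw Dt (twig_base (proj2 (attaching_pointsP _)
      (ex_intro _ w (ex_intro _ t (And3 Jw Dt erefl))))).
    exists (child w (t, b)); first exact: level_child.
    by have [_] := child_wchart Jw lb.
  case: sp => [sp|[w' [Jw' cp]]]; first exact: closureS starts _ (wp_dense wp sp).
  by apply: subset_closure; exists w' => //; rewrite -(n w').
move=> C' psi _ /level_succ[w [x [Jw lx ->]]].
by have [_] := child_wchart Jw lx; rewrite /wstart => ->; exact: attaching_branch.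
Qed.

Lemma well_placed_succ : well_placed i.+1.
Proof.
have hc w' : level i.+1 w' -> parametrizes (wchart w') (warc w').
  by move=> /level_succ[w [x [Jw lx ->]]]; have [] := child_wchart Jw lx.
have hk w' : level i.+1 w' -> kind S i.+1 (warc w') = kindr w'.2.
  by move=> /level_succ[w [x [Jw lx ->]]]; have [] := child_copy Jw lx.
split=> //.
- exact: level_succ_max.
- exact: stage_succ_compact.
- exact: level_succ_sub.
- exact: level_succ_closed.
- exact: level_succ_sep.
have arcs w' : level i.+1 w' -> warc w' `<=` closure (attaching_points D S i.+1).
  move=> Jw' p /(arc_dense Jw' (hc _ Jw')); apply: closureS => _ [t Dt <-].
  by apply: marked_attaching => //; [exact: hk|apply/level_succ_max; exists w'].
move=> p /stage_succ_cover[/(wp_dense wp) sp|[w' [Jw']]]; last exact: arcs.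
(* An attaching point of X_i lies on a new arc, in which the new attaching points are dense; so all
   of X_i consists of limits of new attaching points. *)
rewrite (_ : closure _ = closure (closure (attaching_points D S i.+1))); last first.
  by apply/closure_id; exact: closed_closure.
apply: closureS sp => _ /attaching_pointsP[w [t [Jw Dt ->]]].
have [b lb cb] := twig_cover Jw Dt (twig_base (proj2 (attaching_pointsP _)
  (ex_intro _ w (ex_intro _ t (And3 Jw Dt erefl))))).
by apply: (arcs (child w (t, b))) => //; exact: level_child.
Qed.

End Level.

Lemma well_placed0 : well_placed 0.
Proof.
have [cp meet st0] := base.
have J0 w : level 0 w -> exists j, w = (j, [::]).
  by case: w => j [|x l] [] //= _ _; exists j.
have hc w : level 0 w -> parametrizes (wchart w) (warc w).
  by move=> /J0[j ->]; have [] := cp j.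
have hs w : level 0 w -> wstart w = o by move=> /J0[j ->]; have [] := cp j.
have hk w : level 0 w -> kind S 0 (warc w) = kindr w.2.
  by move=> /J0[j ->]; have [] := cp j.
have J j : level 0 (j, [::]) by [].
have Ao j : A0 j o.
  by have := parametrizes_mem (hc _ (J j)) (t := 0); rewrite lexx ler01 -/(wstart _) hs//; apply.
have sub w : level 0 w -> warc w `<=` stage S 0.
  by move=> /J0[j ->] p Ap; rewrite st0; exists j.
have clA j : closed (A0 j) by exact: parametrizes_closed (hc _ (J j)).
have cl w : level 0 w -> closed (stage S 0 `\` (warc w `\ wstart w)).
  move=> Jw; rewrite hs//; have [j e] := J0 _ Jw.
  suff -> : stage S 0 `\` (warc w `\ o) = \bigcup_(k in [set k | k != j]) A0 k.
    by apply: closed_bigcup => //; exact: finite_finset.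
  rewrite e st0; apply/seteqP; split=> p.
    move=> [[k _ Ap] n]; have [kj|kj] := eqVneq k j; last by exists k.
    have -> : p = o by apply: contrapT => po; apply: n; split=> //; rewrite -kj.
    (* The centre [o] has to be found on an arm other than [j]. *)
    exists (if j == ord0 then ord_max else ord0) => //=.
    by case: (j =P ord0) => [->//|/eqP]; rewrite eq_sym.
  move=> [k /= kj Ap]; split; first by exists k.
  move=> [Ajp]; apply; have : (A0 k `&` A0 j) p by split.
  by rewrite meet.
have sep w w' p : level 0 w -> level 0 w' -> warc w p -> warc w' p ->
    w = w' \/ p = wstart w.
  move=> Jw Jw'; rewrite hs//; have [j ->] := J0 _ Jw; have [k ->] := J0 _ Jw'.
  move=> Ap Ap'; have [->|jk] := eqVneq j k; [by left|right].
  by have : (A0 j `&` A0 k) p; [split|rewrite meet].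
have mx C : maximal_free_arc (stage S 0) C <-> exists2 w, level 0 w & C = warc w.
  apply: (@maximal_free_arcP _ _ (level 0) (stage S 0) warc wchart) => //.
  - move=> p; rewrite st0 => -[j _ Ap] n; apply: subset_closure.
    by exists (j, [::]) => //; rewrite (n (j, [::])).
  - move=> C' psi w Jw hC CY oC.
    have -> : wchart w 0 = o by exact: hs.
    (* Three of the four arms already form a triod at [o]. *)
    pose legs (k : 'I_3) := wchart (widen_ord (leqnSn 3) k, [::]).
    apply: (@no_triod _ (stage S 0) C' psi o legs hC oC).
      move=> k; rewrite -(hs _ (J (widen_ord (leqnSn 3) k))).
      exact: (chart_leg (J _) (hc _ (J _)) (sub _ (J _))).
    move=> k l s t kl s01 t01 e.
    have := sep _ _ (legs k s) (J (widen_ord (leqnSn 3) k)) (J (widen_ord (leqnSn 3) l)).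
    case.
    - exact: (parametrizes_mem (hc _ (J _))).
    - by rewrite e; exact: (parametrizes_mem (hc _ (J _))).
    - move=> ww; case/negP: kl; apply/eqP/val_inj.
      exact: (congr1 (fun w : 'I_4 * rword => val w.1) ww).
    by rewrite hs.
split=> //.
- have -> : stage S 0 = \big[setU/set0]_(k <- enum 'I_4) A0 k.
    by rewrite st0 -bigcup_seq; apply/seteqP; split=> p [k _ Ap]; exists k;
      rewrite //= mem_enum.
  by apply: bigsetU_compact => k _; exact: parametrizes_compact (hc _ (J k)).
move=> p; rewrite st0 => -[j _ Ap].
apply: closureS (arc_dense (J j) (hc _ (J j)) Ap) => _ [t Dt <-].
by apply: marked_attaching => //; [exact: hk|apply/mx; exists (j, [::])].
Qed.

Lemma well_placed_all i : well_placed i.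
Proof. by elim: i => [|i]; [exact: well_placed0|exact: well_placed_succ]. Qed.

(** * Coordinates of the points of the limit *)

Definition arc_coord (w : 'I_4 * rword) (p : plane) : R :=
  if `[< validr w.2 /\ warc w p >] then param_inv (wchart w) p else 0.

Let levelw w : validr w.2 -> level (size w.2) w. Proof. by []. Qed.
Let hchart w : validr w.2 -> parametrizes (wchart w) (warc w).
Proof. by move=> vw; exact: (wp_chart (well_placed_all _) (levelw vw)). Qed.

Lemma arc_coordE w t : validr w.2 -> 0 <= t <= 1 -> arc_coord w (wchart w t) = t.
Proof.
move=> vw t01; rewrite /arc_coord asboolT; first exact: param_invK (hchart vw) t01.
by split=> //; exact: (parametrizes_mem (hchart vw)).
Qed.

Lemma arc_coord_out w p : ~ warc w p -> arc_coord w p = 0.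
Proof. by move=> n; rewrite /arc_coord asboolF// => -[]. Qed.

Lemma arc_coord_start w : arc_coord w (wstart w) = 0.
Proof.
have [vw|n] := pselect (validr w.2); first by apply: arc_coordE => //; rewrite lexx ler01.
by rewrite /arc_coord asboolF// => -[].
Qed.

Lemma arc_coord_neq0 w p : arc_coord w p != 0 ->
  [/\ validr w.2, warc w p, 0 < arc_coord w p <= 1,
    wchart w (arc_coord w p) = p & p <> wstart w].
Proof.
move=> n; have ns : p <> wstart w by move=> e; move: n; rewrite e arc_coord_start eqxx.
move: n; rewrite /arc_coord; case: asboolP => [[vw wp] n|_]; last by rewrite eqxx.
have [/andP[i0 i1] ip] := param_invP (hchart vw) wp.
by split=> //; rewrite i1 andbT lt_neqAle eq_sym n.
Qed.

Lemma arc_coord_range w p : 0 <= arc_coord w p <= 1.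
Proof.
have [->|/arc_coord_neq0[_ _ /andP[h0 h1] _ _]] := eqVneq (arc_coord w p) 0.
  by rewrite lexx ler01.
by rewrite h1 ltW.
Qed.

(** The stage is the union of two closed sets, the arc and the rest together with the start; they
    meet only in the start, where both formulas give 0. *)
Lemma arc_coord_continuous w : validr w.2 ->
  {within stage S (size w.2), continuous (arc_coord w)}.
Proof.
move=> vw; have wp := well_placed_all (size w.2); have Jw := levelw vw.
have -> : stage S (size w.2) =
    warc w `|` (stage S (size w.2) `\` (warc w `\ wstart w)).
  apply/seteqP; split=> p; last by case=> [/(wp_sub wp Jw)|[]].
  by move=> sp; have [wp'|n] := pselect (warc w p); [left|right; split=> // -[]].
apply: withinU_continuous.
- exact: parametrizes_closed (hchart vw).
- exact: (wp_closed wp Jw).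
- apply: subspace_eq_continuous (param_inv_continuous (hchart vw)) => p.
  by rewrite inE => cp; rewrite /from_subspace /arc_coord asboolT.
apply: (@subspace_eq_continuous _ _ _ (fun=> 0)); last first.
  by apply: continuous_subspaceT => x; exact: cvg_cst.
move=> p; rewrite inE => -[_ n]; rewrite /from_subspace.
have [->|ns] := pselect (p = wstart w); first by rewrite arc_coord_start.
by rewrite arc_coord_out// => cp; apply: n; split.
Qed.

Lemma bond_stage i p : stage S i p -> bond D S i p = p.
Proof. by move=> sp; rewrite /bond mem_set. Qed.

Lemma bond_twig i a p : attaching_points D S i a -> twig S i a p -> bond D S i p = a.
Proof.
move=> aa tp; rewrite /bond; case: ifPn => [|n].
  rewrite inE => sp; have : (stage S i `&` twig S i a) p by split.
  by rewrite (tower_meet hS aa).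
apply: xget_unique; first by split.
by move=> b [ab bp]; exact: (twig_unique ab aa bp tp).
Qed.

Local Notation X := (limit_dendrite D S).

(** An arc whose address has length n lies in X_n, and the n-th entry of [x] is its retraction to
    X_n; so the projection to the arc is read off that entry. *)
Definition point_coord (x : X) (j : 'I_4) (s : rword) : R :=
  arc_coord (j, rev s) (set_val x (size s)).

Let stage_mem (x : X) i : stage S i (set_val x i).
Proof. by have /set_mem /= /(_ i)[] := valP x. Qed.
Let bond_mem (x : X) i : bond D S i (set_val x i.+1) = set_val x i.
Proof. by have /set_mem /= /(_ i)[] := valP x. Qed.

Lemma child_below (p q : plane) i w x : level i.+1 (child w x) ->
  bond D S i q = p -> warc (child w x) q -> p = wchart w x.1.
Proof.
move=> [[/= vw lx] [sw]] bq cq; have Jw : level i w by [].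
have wp := well_placed_all i.
rewrite -bq; apply: bond_twig; first exact: (attaching_child wp Jw lx).
exact: (child_sub wp Jw lx).
Qed.

Lemma point_coord_coherent (x : X) : coherent D (point_coord x).
Proof.
have par j s y : point_coord x j (rcons s y) != 0 -> point_coord x j s = y.1.
  rewrite /point_coord rev_rcons size_rcons => /arc_coord_neq0[vw cq _ _ _].
  have [/= vs [Dy _]] := vw.
  have Jc : level (size s).+1 (child (j, rev s) y) by split=> //=; rewrite size_rev.
  rewrite (child_below Jc (bond_mem x _) cq).
  by apply: arc_coordE => //; exact: marking_le01 Dy.
split=> [j|j k]; first split.
- by move=> s; exact: arc_coord_range.
- by move=> s /arc_coord_neq0[/validr_rev].
- exact: par.
- move=> s y z; rewrite /point_coord !rev_rcons !size_rcons => ny nz.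
  have [vy cy _ _ sy] := arc_coord_neq0 ny; have [vz cz _ _ _] := arc_coord_neq0 nz.
  have wp := well_placed_all (size s).+1.
  have Jy : level (size s).+1 (j, y :: rev s) by split=> //=; rewrite size_rev.
  have Jz : level (size s).+1 (j, z :: rev s) by split=> //=; rewrite size_rev.
  by case: (wp_sep wp Jy Jz cy cz) => [[]|/sy].
move=> nj nk; have [vj cj _ _ sj] := arc_coord_neq0 nj.
have [vk ck _ _ _] := arc_coord_neq0 nk.
by case: (wp_sep (well_placed_all 0) (levelw vj) (levelw vk) cj ck) => [[]|/sj].
Qed.

Lemma point_coord_continuous j s : continuous (fun x : X => point_coord x j s).
Proof.
have [v|nv] := pselect (validr (rev s)); last first.
  have -> : (fun x : X => point_coord x j s) = fun=> 0; last exact: (@cst_continuous X R 0).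
  by apply/funext => x; rewrite /point_coord /arc_coord asboolF// => -[].
have := arc_coord_continuous (w := (j, rev s)) v; rewrite /= size_rev => cg.
apply: (continuous_within_comp _ _ cg (f := fun x : X => set_val x (size s))) => x.
  apply: (@continuous_comp _ (prod_topology (fun _ : nat => plane)) _ set_val
    (fun f => f (size s))).
    exact: initial_continuous.
  exact: proj_continuous.
exact: stage_mem.
Qed.

(** A nonzero coordinate names the arc and the position on it; if all vanish, the point is the
    common start [a]. *)
Lemma arc_coord_separate (F : set ('I_4 * rword)) a p q :
  (forall w, F w -> validr w.2 /\ wstart w = a) ->
  (exists2 w, F w & warc w p) -> (exists2 w, F w & warc w q) ->
  (forall w, F w -> arc_coord w p = arc_coord w q) -> p = q.
Proof.
move=> hF; wlog : p q / p <> a => [th hp hq e|pa [w Fw wp] _ e].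
  have [pa|pa] := pselect (p = a); last exact: th.
  have [qa|qa] := pselect (q = a); first by rewrite pa qa.
  by apply/esym; apply: th => // w Fw; rewrite e.
have [vw sw] := hF w Fw.
have [t t01 tp] := parametrizes_surj (hchart vw) wp.
have pt : arc_coord w p = t by rewrite -tp arc_coordE.
have t0 : t != 0 by apply/eqP => t0; apply: pa; rewrite -tp t0.
have qt : arc_coord w q != 0 by rewrite -e// pt.
by have [_ _ _ <- _] := arc_coord_neq0 qt; rewrite -e// pt.
Qed.

Lemma point_coord_inj : injective point_coord.
Proof.
move=> x y xy.
have val_eq i w : size w.2 = i -> arc_coord w (set_val x i) = arc_coord w (set_val y i).
  case: w => j l /= <-; have := congr1 (fun f => f j (rev l)) xy.
  by rewrite /point_coord revK size_rev.
have eqi i : set_val x i = set_val y i.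
  elim: i => [|i IH].
    have [cp _ st0] := base.
    have h (z : X) : exists2 w, level 0 w & warc w (set_val z 0%N).
      have := stage_mem z 0; rewrite st0 => -[j _ Aj].
      by exists (j, [::]).
    apply: (arc_coord_separate (F := level 0) (a := o)) => //.
    - move=> [j [|? ?]] [//= v] _; split=> //.
      by have [] := cp j.
    - by move=> w [_ /val_eq].
  have wp := well_placed_all i.
  (* Off the attaching points the next entry repeats the present one. At an attaching point both
     next entries lie in its twig, whose arcs have separating coordinates. *)
  have [aa|na] := pselect (attaching_points D S i (set_val x i)); last first.
    have st (z : X) : set_val z i = set_val x i -> set_val z i.+1 = set_val x i.
      move=> zx; rewrite -zx -(bond_mem z i).
      have := stage_mem z i.+1; rewrite (tower_step hS) => -[/bond_stage->//|[a aa ta]].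
      by case: na; rewrite -zx -(bond_mem z i) (bond_twig aa ta).
    by rewrite !st.
  have tw (z : X) : set_val z i = set_val x i -> twig S i (set_val x i) (set_val z i.+1).
    move=> zx; have := stage_mem z i.+1; rewrite (tower_step hS) => -[sz|[a ab ta]].
      rewrite -(bond_stage sz) bond_mem zx; exact: twig_base.
    by rewrite -zx -(bond_mem z i) (bond_twig ab ta).
  have [w [t [Jw Dt xt]]] := (attaching_pointsP wp _).1 aa.
  pose F := [set w' | exists2 b, letter D (kindr w.2) (t, b) & w' = child w (t, b)].
  apply: (arc_coord_separate (F := F) (a := set_val x i)).
  - move=> _ [b lb ->]; have [_ ->] := child_wchart wp Jw lb.
    by have [] := level_child Jw lb.
  - have [|b lb cb] := twig_cover wp Jw Dt (p := set_val x i.+1); first by rewrite -xt; exact: tw.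
    by exists (child w (t, b)) => //; exists b.
  - have [|b lb cb] := twig_cover wp Jw Dt (p := set_val y i.+1); first by rewrite -xt; exact: tw.
    by exists (child w (t, b)) => //; exists b.
  - by move=> _ [b lb ->]; apply: val_eq; have [_ ->] := level_child Jw lb.
by apply: val_inj; apply/funext => i; exact: eqi.
Qed.

(** * Every coherent family comes from a point *)

Section Realize.
Variable xi : 'I_4 -> rword -> R.
Hypothesis cxi : coherent D xi.

Let val w := xi w.1 (rev w.2).
Let above i w := level i w /\ val w != 0.

Let val_valid w : val w != 0 -> validr w.2.
Proof. by move=> /(coherent_valid (cxi.1 _))/validr_rev; rewrite revK. Qed.

Let val_range w : 0 <= val w <= 1.
Proof. exact: (coherent_range (cxi.1 _)). Qed.

Let above_unique i w w' : above i w -> above i w' -> w = w'.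
Proof.
case: w w' => j l [j' l'] [[/= _ sl] n] [[/= _ sl'] n'].
have [ct arms] := cxi.
have jj : j = j'.
  by apply: arms; [exact: (coherent_cat hD (s := [::]) (ct j) n)|exact: (coherent_cat hD (s := [::]) (ct j') n')].
subst j'; congr (_, _); apply: (can_inj revK).
by apply: (coherent_unique hD (ct j) n n'); rewrite !size_rev sl.
Qed.

(** When no arc of level [i] has a nonzero value, the prescribed path has ended earlier and the
    point of the previous stage is kept, or [o] at stage 0. *)
Fixpoint realize i : plane :=
  if pselect (exists w, above i w) is left e
  then wchart (sval (cid e)) (val (sval (cid e)))
  else if i is i'.+1 then realize i' else o.

Let realize_above i w : above i w -> realize i = wchart w (val w).
Proof.
move=> aw; case: i aw => [|i] aw /=; case: pselect => [e|[]]; try by exists w.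
  by case: cid => w' aw' /=; rewrite (above_unique aw' aw).
by case: cid => w' aw' /=; rewrite (above_unique aw' aw).
Qed.

Let realize_none i : (forall w, ~ above i w) ->
  realize i = if i is i'.+1 then realize i' else o.
Proof. by move=> n; case: i n => [|i] n /=; case: pselect => // e; exfalso; case: (e) => w; exact: n. Qed.

Let realize_stage i : stage S i (realize i).
Proof.
have wp := well_placed_all.
have st k w : above k w -> stage S k (realize k).
  move=> aw; rewrite (realize_above aw); case: aw => Jw _; apply: (wp_sub (wp _) Jw).
  exact: (parametrizes_mem (wp_chart (wp _) Jw)).
elim: i => [|i IH].
  have [[w /st//]|/forallNP n] := pselect (exists w, above 0 w).
  rewrite (realize_none n); have Jw : level 0 (ord0, [::]) by [].
  apply: (wp_sub (wp _) Jw); have [cp _ _] := base; have [_ h <-] := cp ord0.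
  by apply: (parametrizes_mem h); rewrite lexx ler01.
have [[w /st//]|/forallNP n] := pselect (exists w, above i.+1 w).
by rewrite (realize_none n) (tower_step hS); left.
Qed.

Let realize_coord i w : level i w -> arc_coord w (realize i) = val w.
Proof.
move=> Jw; have wp := well_placed_all.
have [[w0 aw]|/forallNP n] := pselect (exists w, above i w).
  rewrite (realize_above aw); have [ww|ne] := pselect (w = w0).
    by rewrite ww arc_coordE//; apply: val_valid; case: aw.
  have -> : val w = 0.
    by apply: contra_notP ne => /eqP nv; apply: (above_unique (i := i)).
  apply: contra_notP ne => /eqP /arc_coord_neq0[_ cw _ _ nw].
  have [Jw0 _] := aw.
  have c0 := parametrizes_mem (wp_chart (wp _) Jw0) (val_range w0).
  by case: (wp_sep (wp _) Jw Jw0 cw c0).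
have -> : val w = 0.
  by apply: contrapT => /eqP nv; apply: (n w).
rewrite (realize_none n); case: i Jw n => [|i] Jw n.
  case: w Jw => j [|? ?] [] // _ _; have [cp _ _] := base; have [_ _ <-] := cp j.
  exact: (arc_coord_start (j, [::])).
(* The point has stayed in X_i, which a new arc meets only in its start, where the coordinate is
   0. *)
have [cw|/arc_coord_out//] := pselect (warc w (realize i)).
move/level_succ: Jw cw => [u [x [Ju lx ->]]] cw.
rewrite (child_stage (wp _) Ju lx cw (realize_stage i)).
by have [_ <-] := child_wchart (wp _) Ju lx; exact: arc_coord_start.
Qed.

Let realize_bond i : bond D S i (realize i.+1) = realize i.
Proof.
have wp := well_placed_all.
have [[w0 aw]|/forallNP n] := pselect (exists w, above i.+1 w); last first.
  by rewrite [realize i.+1](realize_none n) bond_stage.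
rewrite (realize_above aw); have [Jw0 nz] := aw.
have := Jw0 => /level_succ[w [x [Jw lx e]]]; rewrite e in Jw0 nz *.
have vw : val w = x.1.
  by apply: (coherent_parent (cxi.1 _)); move: nz; rewrite /val /= rev_cons.
have aw' : above i w.
  by split=> //; rewrite vw gt_eqF// (marking_gt0 hD (proj1 lx)).
rewrite (realize_above aw') vw; apply: (child_below Jw0 erefl).
exact: (parametrizes_mem (wp_chart (wp _) Jw0)).
Qed.

Lemma point_coord_surj : exists x, point_coord x = xi.
Proof.
have mem : [set x : prod_topology (fun _ : nat => plane) |
    forall i, stage S i (x i) /\ bond D S i (x i.+1) = x i] realize.
  by move=> i; split; [exact: realize_stage|exact: realize_bond].
exists (exist _ realize (mem_set mem)); apply/funext => j; apply/funext => s.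
rewrite /point_coord set_valE /=.
have [v|n] := pselect (validr (rev s)).
  by rewrite -(size_rev s) realize_coord// /val /= revK.
rewrite /arc_coord asboolF; last by case.
by apply/esym; apply: contra_notP n => /eqP /(coherent_valid (cxi.1 _))/validr_rev.
Qed.

End Realize.

(** The graph is the diagonal of X_i together with the products of {a} and T(a), again a null
    family. Closed graphs make the limit a closed subset of the product of the compact stages. *)
Lemma bond_graph_closed i : closed [set pq : plane * plane |
  [/\ stage S i pq.1, stage S i.+1 pq.2 & bond D S i pq.2 = pq.1]].
Proof.
have wp := well_placed_all i.
have hcl (A : set (plane * plane)) : compact A -> closed A.
  exact: (compact_closed (@norm_hausdorff R (plane * plane)%type)).
have -> : [set pq : plane * plane |
    [/\ stage S i pq.1, stage S i.+1 pq.2 & bond D S i pq.2 = pq.1]] =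
  (fun p => (p, p)) @` stage S i `|`
    \bigcup_(a in attaching_points D S i) ([set a] `*` twig S i a).
  apply/seteqP; split=> -[p q] /=.
    move=> [sp + bq]; rewrite (tower_step hS) => -[sq|[a aa ta]].
      by left; exists p => //; rewrite -{2}bq bond_stage.
    by right; exists a => //; split=> //=; rewrite -bq (bond_twig aa ta).
  move=> [[a sa [<- <-]]|[a aa [/= -> ta]]].
    by split; [|rewrite (tower_step hS); left|exact: bond_stage].
  split; first exact: (attaching_stage wp).
    by rewrite (tower_step hS); right; exists a.
  exact: bond_twig.
apply: closed_null_union.
- apply: hcl; apply: continuous_compact; last exact: (wp_compact wp).
  by apply: continuous_subspaceT; apply: continuous_prod => p; exact: cvg_id.
- move=> a aa; apply: hcl; apply: compact_setX; first exact: compact_set1.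
  exact: twig_compact.
- move=> a aa; exists (a, a); split; first by exists a => //; exact: (attaching_stage wp).
  by split=> //=; exact: (twig_base aa).
move=> e e0; apply: (sub_finite_set _ (@twig_null i e e0)) => a [aa n]; split=> // all.
apply: n => -[p q] [p' q'] [/= -> tq] [/= -> tq'].
by split; [exact: ballxx|exact: all].
Qed.

Lemma limit_compact : compact [set: X].
Proof.
set A := [set x : prod_topology (fun _ : nat => plane) |
    forall i, stage S i (x i) /\ bond D S i (x i.+1) = x i].
have cA : compact A.
  apply: (@subclosed_compact _ _ [set f : prod_topology (fun _ : nat => plane) |
    forall i, stage S i (f i)]); last by move=> x Ax i; have [] := Ax i.
  - have -> : A = \bigcap_i ((fun x : prod_topology (fun _ : nat => plane) =>
        (x i, x i.+1)) @^-1` [set pq : plane * plane |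
        [/\ stage S i pq.1, stage S i.+1 pq.2 & bond D S i pq.2 = pq.1]]).
      apply/seteqP; split=> x Ax i.
        by move=> _; have [? ?] := Ax i; have [? _] := Ax i.+1.
      by have [] := Ax i I.
    apply: closed_bigI => i _.
    have cf : continuous (fun x : prod_topology (fun _ : nat => plane) => (x i, x i.+1)).
      by apply: continuous_prod; [exact: (@proj_continuous _ _ i)
        |exact: (@proj_continuous _ _ i.+1)].
    by move/continuous_closedP: cf; apply; exact: bond_graph_closed.
  - by apply: tychonoff => i; exact: (wp_compact (well_placed_all i)).
move=> F PF _.
have [|p [Ap clp]] := cA (set_val @ F) _.
  by apply: (@filterS _ F _ setT) filterT => x _; exact: set_valP.
exists (exist _ p (mem_set Ap)); split=> // B C FB [C' [[W oW <-] Wp WC]].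
have FB' : (set_val @ F) (set_val @` (B : set X)).
  by apply: (@filterS _ F _ B _ _ FB) => x Bx; exists x.
have [_ [[x Bx <-] Wx]] := clp _ W FB' (open_nbhs_nbhs (conj oW Wp)).
by exists x; split=> //; exact: WC.
Qed.

End Tower.

Lemma tower_coordinates (R : realType) (D : bool -> set R) (S : tower R) :
  dense_marking D -> dendrite_tower D S ->
  exists r : limit_dendrite D S -> 'I_4 -> seq (R * bool) -> R, coordinates D r.
Proof.
move=> hD hS; have [centre [A0 base]] := tower_base hS.
exists (@point_coord _ D S hS A0); split.
- exact: (@limit_compact _ D S hD hS centre A0 base).
- exact: (@point_coord_continuous _ D S hD hS centre A0 base).
- exact: (@point_coord_inj _ D S hD hS centre A0 base).
- exact: (@point_coord_coherent _ D S hD hS centre A0 base).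
exact: (@point_coord_surj _ D S hD hS centre A0 base).
Qed.

Theorem theorem3p5 (R : realType) (D : bool -> set R) (S : tower R)
    (hD : dense_marking D) (hS : dendrite_tower D S) :
  ~ tame1 R (@homeo_act (limit_dendrite D S)).
Proof.
move=> [fc _]; have [r hr] := tower_coordinates hD hS.
(* Any mark of T_0 below 1/2 can serve as the common letter of the ends, as it is red. *)
have [|||c Dc /andP[_ ch]] := @dense_between _ _ (@marking_dense _ _ hD false) 0 (1 / 2).
- by [].
- lra.
- lra.
exact: (not_first_countable_ellis hD hr Dc ch fc).
Qed.
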